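(* Let $E=F+G:\mathbb{H}\to\mathbb{R}$ be the discretized Landau–Brazovskii energy defined in the context, and assume it is bounded below. Let $\Phi_0\in\mathbb{H}$, let $\mathcal{M}\subset\mathbb{H}$ be the closed ball containing the sublevel set $\{\Phi\in\mathbb{H}:E[\Phi]\le E[\Phi_0]\}$, and let $\{\Phi_k\}$ be the sequence generated by the adaptive accelerated proximal gradient (APG) algorithm described in the context, started at $\Phi_0$, with step sizes $\alpha_k$. If $\Phi_k\in\mathcal{M}$ for all $k$ and $\liminf_{k}\alpha_k=\bar\alpha>0$, then $\{\Phi_k\}$ has the global convergence property, i.e. there exists a point $\Phi^*$ such that $\nabla E[\Phi^*]=0$ and $\lim_{k\to+\infty}\Phi_k=\Phi^*$.
   Context: Discretized energy. Let $d\ge1$, let $\mathbf{B}\in\mathbb{R}^{d\times d}$ be invertible, let $\xi,\tau,\gamma\in\mathbb{R}$, let $N_1,\dots,N_d$ be nonnegative even integers, and let $K=\{h\in\mathbb{Z}^d: |h_j|\le N_j/2,\ j=1,\dots,d\}$. Let $\mathbb{H}$ be the real vector space of families $\Phi=(\phi(h))_{h\in K}$ of complex numbers with $\phi(-h)=\overline{\phi(h)}$ (the Fourier coefficients of real-valued trigonometric polynomials), with the real inner product $\langle\Phi,\Psi\rangle=\sum_{h\in K}\phi(h)\overline{\psi(h)}$ and norm $\|\cdot\|$. Define $E=F+G$ with $$G[\Phi]=\frac{\xi^2}{2}\sum_{h\in K}\big(1-(\mathbf{B}h)^T(\mathbf{B}h)\big)^2\phi(h)\phi(-h),$$ $$F[\Phi]=\frac{\tau}{2!}\sum_{h_1+h_2=0}\phi(h_1)\phi(h_2)-\frac{\gamma}{3!}\sum_{h_1+h_2+h_3=0}\phi(h_1)\phi(h_2)\phi(h_3)+\frac{1}{4!}\sum_{h_1+h_2+h_3+h_4=0}\phi(h_1)\phi(h_2)\phi(h_3)\phi(h_4),$$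 all indices ranging over $K$. Gradients are taken with respect to $\langle\cdot,\cdot\rangle$. $G$ is convex, and for $\alpha>0$, $\mathrm{Prox}_G^\alpha(x)=\operatorname{argmin}_{y\in\mathbb{H}}\{G[y]+\frac{1}{2\alpha}\|y-x\|^2\}$. Step size estimation at a point $\Psi$ (with constants $\rho\in(0,1)$ and $\eta>0$). Initialize a trial step $\beta$ by the Barzilai–Borwein method, $\beta=\langle s,s\rangle/\langle s,g\rangle$ or $\beta=\langle s,g\rangle/\langle g,g\rangle$, where $s=\Psi-\Phi_k$ and $g=\nabla F[\Psi]-\nabla F[\Phi_k]$ (when $\Psi=\Phi_k$, $s=\Phi_k-\Phi_{k-1}$ and $g=\nabla F[\Phi_k]-\nabla F[\Phi_{k-1}]$). Then backtrack: compute $\Psi^+=\mathrm{Prox}_G^\beta(\Psi-\beta\nabla F[\Psi])$; if $E[\Psi]-E[\Psi^+]\ge\eta\|\Psi-\Psi^+\|^2$, return $\alpha=\beta$; otherwise replace $\beta$ by $\rho\beta$ and repeat. Adaptive APG algorithm. Initialize $\Phi_1=\Phi_0$, $w_0\in[0,1]$, $N_{max}\in\mathbb{N}$, $k_{ada}=0$, and $\eta\ge\delta>0$ (with the same $\eta$ as in the step size estimation). For $k=1,2,3,\dots$: (i) update the extrapolation weight $w_k\in[0,1]$; (ii) set $\Psi_k=(1+w_k)\Phi_k-w_k\Phi_{k-1}$; (iii) estimate the step size $\alpha_k$ at $\Psi_k$ by the procedure above, and compute $\Psi_{k+1}=\mathrm{Prox}_G^{\alpha_k}(\Psi_k-\alpha_k\nabla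 F[\Psi_k])$; (iv) if $E[\Phi_k]-E[\Psi_{k+1}]\ge\delta\|\Phi_k-\Psi_{k+1}\|^2$ and $k-k_{ada}\le N_{max}$, set $\Phi_{k+1}=\Psi_{k+1}$; (v) otherwise restart: reset $w_k=0$ and $k_{ada}=k$, and set $\Phi_{k+1}=\mathrm{Prox}_G^{\alpha_k}(\Phi_k-\alpha_k\nabla F[\Phi_k])$, where $\alpha_k$ is now the step size estimated at $\Phi_k$ by the procedure above, so that $E[\Phi_k]-E[\Phi_{k+1}]\ge\eta\|\Phi_k-\Phi_{k+1}\|^2$. *)

(* Defs.v *)
From HB Require Import structures.
From mathcomp Require Import all_boot all_order all_algebra.
From mathcomp Require Import complex.
From mathcomp Require Import all_classical all_reals all_analysis.
From mathcomp Require Import zify ring lra.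

Set Implicit Arguments.
Unset Strict Implicit.
Unset Printing Implicit Defensive.

Import Order.TTheory GRing.Theory Num.Theory.
Import numFieldNormedType.Exports.

Local Open Scope classical_set_scope.
Local Open Scope ring_scope.
Local Open Scope complex_scope.

Section Frequencies.
Variables (d : nat) (N : 'I_d -> nat).

Definition in_box (h : 'cV[int]_d) : bool :=
  [forall j, (absz (h j 0%R) <= (N j)./2)%N].

Record freqs := Freq { freq :> 'cV[int]_d; freqP : in_box freq }.

HB.instance Definition _ := [isSub for freq].
HB.instance Definition _ := [Countable of freqs by <:].

Definition freq_code (h : freqs) : {dffun forall j, 'I_(((N j)./2).*2.+1)} :=
  [ffun j => inord (absz (freq h j 0 + Posz ((N j)./2)))].

Definition freq_decode (c : {dffun forall j, 'I_(((N j)./2).*2.+1)}) :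
  option freqs := insub (\col_j (Posz (c j) - Posz ((N j)./2))).

Fact freq_code_subproof (x : int) (m : nat) : (absz x <= m)%N ->
  (absz (x + Posz m)%R < m.*2.+1)%N /\ Posz (absz (x + Posz m)) - Posz m = x.
Proof. by move=> xm; lia. Qed.

Lemma freq_codeK : pcancel freq_code freq_decode.
Proof.
move=> h; rewrite /freq_decode.
have -> : \col_j (Posz (freq_code h j) - Posz ((N j)./2)) = freq h.
  apply/matrixP => j k; rewrite !mxE ffunE (ord1 k).
  have [lt_x eq_x] := freq_code_subproof (forallP (freqP h) j).
  by rewrite inordK.
exact: valK.
Qed.

HB.instance Definition _ : fintype.isFinite freqs := PCanIsFinite freq_codeK.

Lemma in_boxN (h : 'cV[int]_d) : in_box h -> in_box (- h).
Proof. by move=> /forallP hh; apply/forallP => j; rewrite mxE abszN. Qed.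

Definition oppK (h : freqs) : freqs := Freq (in_boxN (freqP h)).

Lemma oppKK : involutive oppK.
Proof. by move=> h; apply: val_inj; rewrite /= opprK. Qed.

End Frequencies.

Section ComplexSums.
Variable R : realType.

Lemma Re_sum (I : Type) (r : seq I) (P : pred I) (f : I -> R[i]) :
  complex.Re (\sum_(i <- r | P i) f i) = \sum_(i <- r | P i) complex.Re (f i).
Proof. by apply: (big_morph (@complex.Re R)) => [[a b] [c e]|]. Qed.

Lemma Im_sum (I : Type) (r : seq I) (P : pred I) (f : I -> R[i]) :
  complex.Im (\sum_(i <- r | P i) f i) = \sum_(i <- r | P i) complex.Im (f i).
Proof. by apply: (big_morph (@complex.Im R)) => [[a b] [c e]|]. Qed.

Lemma conjc_Im (z : R[i]) : conjc z = z -> complex.Im z = 0.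
Proof. by case: z => a b [] /eqP; rewrite eqNr => /eqP. Qed.

End ComplexSums.

Section HermitianFamilies.
Variables (R : realType) (d : nat) (N : 'I_d -> nat).
Local Notation K := (freqs N).

Definition hermitian (phi : {ffun K -> R[i]}) : bool :=
  [forall h, phi (oppK h) == conjc (phi h)].

Record hfam := HFam { coef :> {ffun K -> R[i]}; coefP : hermitian coef }.

HB.instance Definition _ := [isSub for coef].
HB.instance Definition _ := [Choice of hfam by <:].

Lemma coefN (phi : hfam) h : phi (oppK h) = conjc (phi h).
Proof. exact/eqP/(forallP (coefP phi)). Qed.

Fact hermitian_zmod : zmod_closed hermitian.
Proof.
split=> [|f g]; rewrite !unfold_in.
  by apply/forallP => h; rewrite !ffunE conjc0.
move=> /forallP hf /forallP hg; apply/forallP => h.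
by rewrite !ffunE (eqP (hf h)) (eqP (hg h)) rmorphB.
Qed.
HB.instance Definition _ :=
  GRing.isZmodClosed.Build {ffun K -> R[i]} hermitian hermitian_zmod.
HB.instance Definition _ := [SubChoice_isSubZmodule of hfam by <:].

Fact scale_subproof (a : R) (phi : hfam) :
  hermitian [ffun h => a%:C * phi h].
Proof. by apply/forallP => h; rewrite !ffunE coefN rmorphM /= oppr0. Qed.

Definition scale_hfam (a : R) (phi : hfam) : hfam :=
  HFam (scale_subproof a phi).

Lemma hfam_eq (phi psi : hfam) : (forall h, phi h = psi h) -> phi = psi.
Proof. by move=> e; apply/val_inj/ffunP. Qed.

Fact scale_hfamA a b v : scale_hfam a (scale_hfam b v) = scale_hfam (a * b) v.
Proof. by apply: hfam_eq => h; rewrite !ffunE mulrA rmorphM. Qed.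
Fact scale_hfam1 : left_id 1 scale_hfam.
Proof. by move=> v; apply: hfam_eq => h; rewrite !ffunE mul1r. Qed.
Fact scale_hfamDr : right_distributive scale_hfam +%R.
Proof. by move=> a u v; apply: hfam_eq => h; rewrite !ffunE mulrDr. Qed.
Fact scale_hfamDl v : {morph scale_hfam^~ v : a b / a + b}.
Proof. by move=> a b; apply: hfam_eq => h; rewrite !ffunE rmorphD mulrDl. Qed.

HB.instance Definition _ := GRing.Zmodule_isLmodule.Build R hfam
  scale_hfamA scale_hfam1 scale_hfamDr scale_hfamDl.

(* The sum is real: see Im_dot. *)
Definition dot (phi psi : hfam) : R :=
  complex.Re (\sum_(h : K) phi h * conjc (psi h)).

Lemma Im_dot (phi psi : hfam) :
  complex.Im (\sum_(h : K) phi h * conjc (psi h)) = 0.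
Proof.
apply: conjc_Im; rewrite rmorph_sum (reindex_inj (inv_inj (@oppKK _ N))) /=.
by apply: eq_bigr => h _; rewrite rmorphM !coefN /= !conjcK.
Qed.

Lemma dotE phi psi : dot phi psi = \sum_(h : K)
  (complex.Re (phi h) * complex.Re (psi h) +
   complex.Im (phi h) * complex.Im (psi h)).
Proof.
rewrite /dot Re_sum; apply: eq_bigr => h _.
by case: (phi h) (psi h) => [a b] [c e] /=; rewrite mulrN opprK.
Qed.

Lemma dotC phi psi : dot phi psi = dot psi phi.
Proof.
by rewrite !dotE; apply: eq_bigr => h _; congr (_ + _); rewrite mulrC.
Qed.

Lemma dotDl a phi psi chi :
  dot (a *: phi + psi) chi = a * dot phi chi + dot psi chi.
Proof.
rewrite !dotE mulr_sumr -big_split; apply: eq_bigr => h _ /=.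
rewrite !ffunE; case: (phi h) (psi h) (chi h) => [? ?] [? ?] [? ?] /=.
by ring.
Qed.

Lemma dotDr a phi psi chi :
  dot chi (a *: phi + psi) = a * dot chi phi + dot chi psi.
Proof. by rewrite !(dotC chi) dotDl. Qed.

Lemma dot_ge0 phi : 0 <= dot phi phi.
Proof. by rewrite dotE sumr_ge0 // => h _; rewrite addr_ge0 // -expr2 sqr_ge0. Qed.

Lemma dot_eq0 phi : dot phi phi = 0 -> phi = 0.
Proof.
rewrite dotE => /eqP; rewrite psumr_eq0; last first.
  by move=> h _; rewrite addr_ge0 // -expr2 sqr_ge0.
move=> /allP e; apply: hfam_eq => h; rewrite ffunE.
have := e h (mem_index_enum h); rewrite -!expr2 paddr_eq0 ?sqr_ge0 // !sqrf_eq0.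
by case: (phi h) => a b /= /andP[/eqP -> /eqP ->].
Qed.

Lemma cauchy_schwarz phi psi :
  dot phi psi ^+ 2 <= dot phi phi * dot psi psi.
Proof.
have dot0r chi : dot chi 0 = 0.
  by have := dotDr 1 0 0 chi; rewrite scale1r addr0; lra.
have [/dot_eq0 ->|psi0] := eqVneq (dot psi psi) 0.
  by rewrite !dot0r mulr0 expr0n.
have b_gt0 : 0 < dot psi psi by rewrite lt_neqAle eq_sym psi0 dot_ge0.
have := dot_ge0 (dot psi psi *: phi + (- dot phi psi *: psi + 0)).
rewrite !(dotDl, dotDr) !dot0r !(dotC 0) !dot0r (dotC psi phi).
by move=> h; rewrite -subr_ge0 -(pmulr_rge0 _ b_gt0); lra.
Qed.

Definition hnorm phi : R := Num.sqrt (dot phi phi).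


Fact hnormD phi psi : hnorm (phi + psi) <= hnorm phi + hnorm psi.
Proof.
rewrite -[leRHS]ger0_norm ?addr_ge0 ?sqrtr_ge0 // -sqrtr_sqr ler_sqrt ?sqr_ge0 //.
rewrite sqrrD !sqr_sqrtr ?dot_ge0 //.
have -> : dot (phi + psi) (phi + psi) =
    dot phi phi + 2 * dot phi psi + dot psi psi.
  by rewrite -[phi]scale1r !(dotDl, dotDr) scale1r (dotC psi phi); ring.
rewrite lerD2r lerD2l -sqrtrM ?dot_ge0 // -[leRHS]mulr_natl ler_pM2l ?ltr0n //.
by rewrite (le_trans (ler_norm _)) // -sqrtr_sqr ler_wsqrtr // cauchy_schwarz.
Qed.

Fact hnormZ (a : R) phi : hnorm (a *: phi) = `|a| * hnorm phi.
Proof.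
rewrite -[a *: phi]addr0 /hnorm !(dotDl, dotDr).
have -> : dot phi 0 = 0 by have := dotDr 1 0 0 phi; rewrite scale1r addr0; lra.
have z : dot 0 0 = 0 by have := dotDr 1 0 0 0; rewrite scale1r addr0; lra.
have -> : dot 0 phi = 0 by have := dotDl 1 0 0 phi; rewrite scale1r addr0; lra.
by rewrite z mulr0 !addr0 mulrA -expr2 sqrtrM ?sqr_ge0 // sqrtr_sqr.
Qed.

Fact hnorm0_eq0 phi : hnorm phi = 0 -> phi = 0.
Proof.
move/eqP; rewrite sqrtr_eq0 => le0; apply: dot_eq0.
by apply/eqP; rewrite eq_le le0 dot_ge0.
Qed.

HB.instance Definition _ :=
  Lmodule_isNormed.Build R hfam hnormD hnormZ hnorm0_eq0.

Lemma norm_hfamE phi : `|phi| = Num.sqrt (dot phi phi). Proof. by []. Qed.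


Definition re_coef (h : K) (phi : hfam) : R := complex.Re (phi h).
Definition im_coef (h : K) (phi : hfam) : R := complex.Im (phi h).

Fact re_coef_linear h : linear (re_coef h).
Proof.
move=> a u v; rewrite /re_coef !ffunE.
by case: (u h) (v h) => [? ?] [? ?] /=; rewrite mul0r subr0.
Qed.
Fact im_coef_linear h : linear (im_coef h).
Proof.
move=> a u v; rewrite /im_coef !ffunE.
by case: (u h) (v h) => [? ?] [? ?] /=; rewrite mul0r addr0.
Qed.
HB.instance Definition _ h :=
  GRing.isLinear.Build R hfam R *%R (re_coef h) (re_coef_linear h).
HB.instance Definition _ h :=
  GRing.isLinear.Build R hfam R *%R (im_coef h) (im_coef_linear h).

Lemma norm_coef_le h phi :
  re_coef h phi ^+ 2 + im_coef h phi ^+ 2 <= `|phi| ^+ 2.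
Proof.
rewrite norm_hfamE sqr_sqrtr ?dot_ge0 // dotE (bigD1 h) //= !expr2 lerDl.
by rewrite sumr_ge0 // => j _; rewrite addr_ge0 // -expr2 sqr_ge0.
Qed.

Lemma linear_coef_differentiable (f : {linear hfam -> R}) :
  (forall phi, `|f phi| <= `|phi|) -> forall phi, differentiable f phi.
Proof.
move=> fb phi; apply: linear_differentiable; apply: bounded_linear_continuous.
apply/linear_boundedP; near=> r => x; apply: le_trans (fb x) _.
by rewrite ler_peMl //; near: r; apply: nbhs_pinfty_ge.
Unshelve. all: by end_near. Qed.

Lemma re_coef_differentiable h phi : differentiable (re_coef h) phi.
Proof.
apply: linear_coef_differentiable => psi.
rewrite -ler_sqr ?nnegrE ?normr_ge0 // real_normK ?num_real //.
by apply: le_trans (norm_coef_le h psi); rewrite lerDl sqr_ge0.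
Qed.
Lemma im_coef_differentiable h phi : differentiable (im_coef h) phi.
Proof.
apply: linear_coef_differentiable => psi.
rewrite -ler_sqr ?nnegrE ?normr_ge0 // real_normK ?num_real //.
by apply: le_trans (norm_coef_le h psi); rewrite lerDr sqr_ge0.
Qed.

Definition is_gradient (J : hfam -> R) (phi g : hfam) : Prop :=
  differentiable J phi /\ forall v, 'd J phi v = dot g v.

(* The default value 0 is irrelevant where J is differentiable: see gradientP. *)
Definition gradient (J : hfam -> R) (phi : hfam) : hfam :=
  xget 0 [set g | is_gradient J phi g].

Fact basis_re_subproof h0 : hermitian
  [ffun h => ((h == h0)%:R + (h == oppK h0)%:R) / 2].
Proof.
apply/forallP => h; rewrite !ffunE (can2_eq (@oppKK _ N) (@oppKK _ N)).
by rewrite (can_eq (@oppKK _ N)) addrC fmorph_div rmorphD !rmorph_nat.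
Qed.
Fact basis_im_subproof h0 : hermitian
  [ffun h => (0 +i* 1) * ((h == h0)%:R - (h == oppK h0)%:R) / 2].
Proof.
apply/forallP => h; rewrite !ffunE (can2_eq (@oppKK _ N) (@oppKK _ N)).
rewrite (can_eq (@oppKK _ N)) fmorph_div !rmorphM rmorphB !rmorph_nat.
rewrite /= (_ : 0 -i* 1 = - (0 +i* 1)); last by rewrite /GRing.opp /= oppr0.
by rewrite mulNr -mulrN opprB.
Qed.

Definition basis_re h0 := HFam (basis_re_subproof h0).
Definition basis_im h0 := HFam (basis_im_subproof h0).

Lemma hfam_basis phi : phi = \sum_h0
  (re_coef h0 phi *: basis_re h0 + im_coef h0 phi *: basis_im h0).
Proof.
apply: hfam_eq => h.
have -> : forall f : K -> hfam, (\sum_k f k) h = \sum_k f k h.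
  move=> f; pose ev (x : hfam) := x h.
  by apply: (big_morph ev) => [x y|]; rewrite /ev !ffunE.
transitivity (\sum_k (phi k * (h == k)%:R / 2 +
                      conjc (phi k) * (h == oppK k)%:R / 2)).
  rewrite big_split /= (bigD1 h) //= eqxx big1 ?addr0 => [|k /negPf]; last first.
    by rewrite eq_sym => ->; rewrite mulr0 mul0r.
  rewrite (bigD1 (oppK h)) //= oppKK eqxx big1 ?addr0 => [|k]; last first.
    rewrite -(can2_eq (@oppKK _ N) (@oppKK _ N)) eq_sym => /negPf ->.
    by rewrite mulr0 mul0r.
  by rewrite coefN conjcK !mulr1 -mulr2n -[_ *+ 2]mulr_natr divfK ?pnatr_eq0.
apply: eq_bigr => k _; rewrite !ffunE /re_coef /im_coef.
case: (phi k) => a b /=.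
have -> : (a +i* b) = a%:C + (0 +i* 1) * b%:C.
  by apply/eqP; rewrite eq_complex /=; apply/andP; split; apply/eqP; ring.
have -> : (a -i* b) = a%:C - (0 +i* 1) * b%:C.
  by apply/eqP; rewrite eq_complex /=; apply/andP; split; apply/eqP; ring.
by ring.
Qed.

Lemma dot_inj (g g' : hfam) : (forall v, dot g v = dot g' v) -> g = g'.
Proof.
move=> e; apply/eqP; rewrite -subr_eq0 -scaleN1r addrC; apply/eqP/dot_eq0.
by rewrite dotDl e; ring.
Qed.

Lemma riesz (L : {linear hfam -> R}) : exists g, forall v, L v = dot g v.
Proof.
pose c h : R[i] := (L (basis_re h)) +i* (L (basis_im h)).
have c_herm : hermitian [ffun h => c h].
  apply/forallP => h; rewrite !ffunE /c.
  have -> : basis_re (oppK h) = basis_re h.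
    by apply: hfam_eq => k; rewrite !ffunE oppKK addrC.
  have -> : basis_im (oppK h) = - basis_im h.
    apply: hfam_eq => k; rewrite !ffunE oppKK -mulNr -mulrN opprB //.
  by rewrite linearN.
exists (HFam c_herm) => v; rewrite dotE {1}(hfam_basis v) linear_sum.
apply: eq_bigr => h _; rewrite linearD !linearZ /= ffunE /c /=.
by rewrite /re_coef /im_coef; congr (_ + _); rewrite mulrC.
Qed.

Lemma is_gradient_unique J phi g g' :
  is_gradient J phi g -> is_gradient J phi g' -> g = g'.
Proof. by move=> [_ h] [_ h']; apply: dot_inj => v; rewrite -h h'. Qed.

Lemma gradientP J phi : differentiable J phi -> is_gradient J phi (gradient J phi).
Proof.
move=> dJ; have [g Jg] := riesz ('d J phi).
by apply: xgetPex; exists g; split.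
Qed.

Definition is_argmin (J : hfam -> R) (y : hfam) : Prop := forall z, J y <= J z.

Definition prox_obj (G : hfam -> R) (alpha : R) (x y : hfam) : R :=
  G y + (2 * alpha)^-1 * `|y - x| ^+ 2.

(* For G = energyG and alpha > 0 the minimizer exists and is unique: see proxP. *)
Definition prox (G : hfam -> R) (alpha : R) (x : hfam) : hfam :=
  xget 0 [set y | is_argmin (prox_obj G alpha x) y].

End HermitianFamilies.

Section Energy.
Variables (R : realType) (d : nat) (N : 'I_d -> nat).
Variables (B : 'M[R]_d) (xi tau gamma : R).
Local Notation K := (freqs N).
Local Notation H := (hfam R N).

Definition sq_wave (h : K) : R :=
  let Bh := B *m map_mx intr (freq h) in (Bh^T *m Bh) 0 0.

(* The sums in energyG and energyF are real: see Im_energyG and Im_conv. *)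
Definition energyG (phi : H) : R :=
  xi ^+ 2 / 2 *
  complex.Re (\sum_(h : K) ((1 - sq_wave h) ^+ 2)%:C * phi h * phi (oppK h)).

Definition conv (n : nat) (phi : H) : R[i] :=
  \sum_(h : {ffun 'I_n -> K} | \sum_i freq (h i) == 0) \prod_i phi (h i).

Definition energyF (phi : H) : R :=
  tau / (2`!)%:R * complex.Re (conv 2 phi)
  - gamma / (3`!)%:R * complex.Re (conv 3 phi)
  + 1 / (4`!)%:R * complex.Re (conv 4 phi).

Definition energy (phi : H) : R := energyF phi + energyG phi.

Lemma Im_conv n phi : complex.Im (conv n phi) = 0.
Proof.
apply: conjc_Im; pose op (h : {ffun 'I_n -> K}) := [ffun i => oppK (h i)].
have opK : involutive op by move=> h; apply/ffunP => i; rewrite !ffunE oppKK.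
rewrite /conv rmorph_sum (reindex_inj (inv_inj opK)) /=; apply: eq_big => h.
  rewrite (eq_bigr (fun i => - freq (h i))) => [|i _]; last by rewrite ffunE.
  by rewrite sumrN oppr_eq0.
by move=> _; rewrite rmorph_prod; apply: eq_bigr => i _; rewrite ffunE coefN /= conjcK.
Qed.

Lemma sq_waveN h : sq_wave (oppK h) = sq_wave h.
Proof.
by rewrite /sq_wave /= map_mxN mulmxN [(- _)^T]linearN mulNmx mulmxN opprK.
Qed.

Lemma Im_energyG (phi : H) :
  complex.Im (\sum_(h : K) ((1 - sq_wave h) ^+ 2)%:C * phi h * phi (oppK h)) = 0.
Proof.
rewrite Im_sum big1 // => h _; rewrite coefN.
by case: (phi h) => a b /=; ring.
Qed.

Lemma energyGE phi : energyG phi = xi ^+ 2 / 2 *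
  \sum_(h : K) (1 - sq_wave h) ^+ 2 *
    (complex.Re (phi h) ^+ 2 + complex.Im (phi h) ^+ 2).
Proof.
rewrite /energyG Re_sum; congr (_ * _); apply: eq_bigr => h _; rewrite coefN.
by case: (phi h) => a b /=; ring.
Qed.

Lemma is_argmin_energyG alpha (x : H) : 0 < alpha -> exists y0,
  forall y, is_argmin (prox_obj energyG alpha x) y <-> y = y0.
Proof.
move=> alpha_gt0; pose c := (2 * alpha)^-1.
have c_gt0 : 0 < c by rewrite invr_gt0 mulr_gt0.
pose a h := xi ^+ 2 / 2 * (1 - sq_wave h) ^+ 2.
have aE h r : xi ^+ 2 / 2 * ((1 - sq_wave h) ^+ 2 * r) = a h * r.
  by rewrite mulrA.
have ac_gt0 h : 0 < a h + c.
  by rewrite ltr_wpDl // mulr_ge0 ?sqr_ge0 // mulr_ge0 ?sqr_ge0 // invr_ge0.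
have y_herm : hermitian [ffun h => (c / (a h + c))%:C * x h].
  apply/forallP => h; rewrite !ffunE coefN /a sq_waveN.
  case: (x h) (c / _) => u v k; rewrite eq_complex /=.
  by apply/andP; split; apply/eqP; ring.
pose y0 := HFam y_herm; exists y0.
have objE z : prox_obj energyG alpha x z = prox_obj energyG alpha x y0 +
    \sum_h (a h + c) * ((complex.Re (z h) - complex.Re (y0 h)) ^+ 2 +
                        (complex.Im (z h) - complex.Im (y0 h)) ^+ 2).
  rewrite /prox_obj !energyGE !norm_hfamE !sqr_sqrtr ?dot_ge0 // !dotE -/c.
  rewrite !mulr_sumr -!big_split; apply: eq_bigr => h _ /=.
  rewrite !aE !ffunE; case: (z h) (x h) => [z1 z2] [x1 x2] /=.
  have := ac_gt0 h; move: (a h) => b bc_gt0; have bc0 := lt0r_neq0 bc_gt0.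
  by rewrite !(mul0r, subr0, addr0); field.
have sum_ge0 z h : 0 <= (a h + c) *
    ((complex.Re (z h) - complex.Re (y0 h)) ^+ 2 +
     (complex.Im (z h) - complex.Im (y0 h)) ^+ 2).
  by rewrite mulr_ge0 ?(ltW (ac_gt0 h)) // addr_ge0 ?sqr_ge0.
move=> y; split => [min_y|-> z]; last first.
  by rewrite (objE z) lerDl sumr_ge0.
have := min_y y0; rewrite objE gerDl => le0.
have /eqP : \sum_h (a h + c) * ((complex.Re (y h) - complex.Re (y0 h)) ^+ 2 +
    (complex.Im (y h) - complex.Im (y0 h)) ^+ 2) = 0.
  by apply/eqP; rewrite eq_le le0 sumr_ge0.
rewrite psumr_eq0 // => /allP e; apply: hfam_eq => h.
have := e h (mem_index_enum h); rewrite mulf_eq0 (negPf (lt0r_neq0 (ac_gt0 h))) /=.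
rewrite paddr_eq0 ?sqr_ge0 // !sqrf_eq0 !subr_eq0 => ri.
by apply/eqP; rewrite eq_complex.
Qed.

Lemma proxP alpha (x y : H) : 0 < alpha ->
  is_argmin (prox_obj energyG alpha x) y <-> y = prox energyG alpha x.
Proof.
move=> /(is_argmin_energyG x)[y0 min_y0].
suff -> : prox energyG alpha x = y0 by [].
by apply/min_y0; apply: xgetPex; exists y0; apply/min_y0.
Qed.

Definition cdifferentiable (f : H -> R[i]) (phi : H) : Prop :=
  differentiable (fun psi => complex.Re (f psi)) phi /\
  differentiable (fun psi => complex.Im (f psi)) phi.

Lemma cdifferentiable_coef h phi : cdifferentiable (fun psi => psi h) phi.
Proof.
by split; [apply: re_coef_differentiable | apply: im_coef_differentiable].
Qed.

Lemma cdifferentiable_cst z phi : cdifferentiable (fun=> z) phi.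
Proof. by split; apply: differentiable_cst. Qed.

Lemma cdifferentiableD f g phi : cdifferentiable f phi ->
  cdifferentiable g phi -> cdifferentiable (fun psi => f psi + g psi) phi.
Proof.
move=> [rf jf] [rg jg]; split.
  rewrite (_ : (fun _ => _) =
      (fun psi => complex.Re (f psi)) + (fun psi => complex.Re (g psi))).
    exact: differentiableD.
  by apply/funext => psi; rewrite /= fctE; case: (f psi) (g psi) => [? ?] [? ?].
rewrite (_ : (fun _ => _) =
    (fun psi => complex.Im (f psi)) + (fun psi => complex.Im (g psi))).
  exact: differentiableD.
by apply/funext => psi; rewrite /= fctE; case: (f psi) (g psi) => [? ?] [? ?].
Qed.

Lemma cdifferentiableM f g phi : cdifferentiable f phi ->
  cdifferentiable g phi -> cdifferentiable (fun psi => f psi * g psi) phi.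
Proof.
move=> [rf jf] [rg jg]; split.
  rewrite (_ : (fun _ => _) =
      (fun psi => complex.Re (f psi)) * (fun psi => complex.Re (g psi))
      - (fun psi => complex.Im (f psi)) * (fun psi => complex.Im (g psi))).
    by apply: differentiableB; apply: differentiableM.
  by apply/funext => psi; rewrite /= !fctE; case: (f psi) (g psi) => [? ?] [? ?].
rewrite (_ : (fun _ => _) =
    (fun psi => complex.Re (f psi)) * (fun psi => complex.Im (g psi))
    + (fun psi => complex.Im (f psi)) * (fun psi => complex.Re (g psi))).
  by apply: differentiableD; apply: differentiableM.
by apply/funext => psi; rewrite /= !fctE; case: (f psi) (g psi) => [? ?] [? ?].
Qed.

Lemma cdifferentiable_sum (I : Type) (r : seq I) (P : pred I) f phi :
  (forall i, cdifferentiable (f i) phi) ->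
  cdifferentiable (fun psi => \sum_(i <- r | P i) f i psi) phi.
Proof.
move=> df; elim: r => [|i r IHr].
  by under eq_fun do rewrite big_nil; apply: cdifferentiable_cst.
under eq_fun do rewrite big_cons; case: (P i) => //.
exact: cdifferentiableD.
Qed.

Lemma cdifferentiable_prod (I : Type) (r : seq I) (P : pred I) f phi :
  (forall i, cdifferentiable (f i) phi) ->
  cdifferentiable (fun psi => \prod_(i <- r | P i) f i psi) phi.
Proof.
move=> df; elim: r => [|i r IHr].
  by under eq_fun do rewrite big_nil; apply: cdifferentiable_cst.
under eq_fun do rewrite big_cons; case: (P i) => //.
exact: cdifferentiableM.
Qed.

Lemma energyG_differentiable phi : differentiable energyG phi.
Proof.
apply: (@differentiableZ _ _ _ (fun psi : H => complex.Re
  (\sum_(h : K) ((1 - sq_wave h) ^+ 2)%:C * psi h * psi (oppK h)))).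
apply: (cdifferentiable_sum _ _ _).1 => h.
do 2 ![apply: cdifferentiableM; last exact: cdifferentiable_coef].
exact: cdifferentiable_cst.
Qed.

Lemma conv_differentiable n a phi :
  differentiable (fun psi : H => a * complex.Re (conv n psi)) phi.
Proof.
apply: (@differentiableZ _ _ _ (fun psi : H => complex.Re (conv n psi))).
apply: (cdifferentiable_sum _ _ _).1 => h.
by apply: cdifferentiable_prod => i; apply: cdifferentiable_coef.
Qed.

Lemma energyF_differentiable phi : differentiable energyF phi.
Proof.
apply: (@differentiableD _ _ _
  (fun psi => tau / (2`!)%:R * complex.Re (conv 2 psi)
    - gamma / (3`!)%:R * complex.Re (conv 3 psi))); last exact: conv_differentiable.
by apply: differentiableB; apply: conv_differentiable.
Qed.

Lemma energy_differentiable phi : differentiable energy phi.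
Proof.
apply: differentiableD; [exact: energyF_differentiable|].
exact: energyG_differentiable.
Qed.

End Energy.

Section Algorithm.
Variables (R : realType) (d : nat) (N : 'I_d -> nat).
Local Notation H := (hfam R N).
Variables (F G : H -> R) (rho eta delta : R) (Nmax : nat).
Implicit Types (Phi Psi : H) (alpha beta w : R).

Let E (phi : H) : R := F phi + G phi.

Definition prox_step Psi beta : H :=
  prox G beta (Psi - beta *: gradient F Psi).

(* Both Barzilai-Borwein quotients are well defined and positive exactly when
   dot s g > 0. Otherwise (in particular when s = 0, as in the very first
   iteration, where Phi_1 = Phi_0) they give no admissible step, since Prox
   needs a positive parameter, and any positive trial step is allowed. *)
Definition bb_trial Phi Phi_prev Psi beta : Prop :=
  let ref := if Psi == Phi then Phi_prev else Phi in
  let s := Psi - ref in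
  let g := gradient F Psi - gradient F ref in
  if 0 < dot s g then beta = dot s s / dot s g \/ beta = dot s g / dot g g
  else 0 < beta.

Definition backtrack_ok Psi beta : Prop :=
  E Psi - E (prox_step Psi beta) >= eta * `|Psi - prox_step Psi beta| ^+ 2.

Definition step_estimate Phi Phi_prev Psi alpha : Prop :=
  exists beta m, [/\ bb_trial Phi Phi_prev Psi beta,
    alpha = rho ^+ m * beta,
    backtrack_ok Psi alpha &
    forall j, (j < m)%N -> ~ backtrack_ok Psi (rho ^+ j * beta)].

Definition extrapolate w Phi Phi_prev : H := (1 + w) *: Phi - w *: Phi_prev.

Definition no_restart k kada Phi Psi' : Prop :=
  E Phi - E Psi' >= delta * `|Phi - Psi'| ^+ 2 /\ (k - kada <= Nmax)%N.

(* Iteration k, from Phi_k, Phi_(k-1), k_ada to w_k, alpha_k, the new k_ada and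
   Phi_(k+1). The rule for the extrapolation weight in [0, 1] is free. *)
Inductive apg_step (k : nat) Phi Phi_prev (kada : nat) :
    R -> R -> nat -> H -> Prop :=
| apg_accept w alpha (Psi := extrapolate w Phi Phi_prev) :
    0 <= w <= 1 ->
    step_estimate Phi Phi_prev Psi alpha ->
    no_restart k kada Phi (prox_step Psi alpha) ->
    apg_step k Phi Phi_prev kada w alpha kada (prox_step Psi alpha)
| apg_restart w alpha0 alpha (Psi := extrapolate w Phi Phi_prev) :
    0 <= w <= 1 ->
    step_estimate Phi Phi_prev Psi alpha0 ->
    ~ no_restart k kada Phi (prox_step Psi alpha0) ->
    step_estimate Phi Phi_prev Phi alpha ->
    apg_step k Phi Phi_prev kada 0 alpha k (prox_step Phi alpha).

(* [kada k] is the value of k_ada at the beginning of iteration k. *)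
Definition apg_run (Phi : nat -> H) (w alpha : nat -> R) (kada : nat -> nat) :
    Prop :=
  [/\ Phi 1%N = Phi 0%N, 0 <= w 0%N <= 1, kada 1%N = 0%N &
      forall k, (0 < k)%N ->
        apg_step k (Phi k) (Phi k.-1) (kada k)
          (w k) (alpha k) (kada k.+1) (Phi k.+1)].

End Algorithm.

(* Main.v *)
Require Import Defs.
From HB Require Import structures.
From mathcomp Require Import all_boot all_order all_algebra.
From mathcomp Require Import complex.
From mathcomp Require Import all_classical all_reals all_analysis.
From mathcomp Require Import polyrcf ordered_qelim qe_rcf.
From mathcomp Require Import zify ring lra.
Set Implicit Arguments.
Unset Strict Implicit.
Unset Printing Implicit Defensive.
Import Order.TTheory GRing.Theory Num.Theory.
Import numFieldNormedType.Exports.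
Local Open Scope classical_set_scope.
Local Open Scope ring_scope.

(* The iterates decrease E by at least delta |x_k - x_(k+1)|^2, and the gradient
   of E at x_(k+1) is O(|x_k - x_(k+1)| + |x_(k-1) - x_k|). The classical
   argument then gives finite length, provided E satisfies a
   Kurdyka-Lojasiewicz inequality. As E is a polynomial, this is obtained from
   quantifier elimination over real closed fields. On a box, choose x(t)
   definably among the points of least slope on the level {E = l + t}. For each
   c, the set of t with c < x_i(t) is given by polynomial sign conditions of
   degree in t bounded independently of c, so its indicator alternates at most
   k times, uniformly in c; hence (Banach indicatrix) t |-> x(t) has bounded
   variation. If W(t) is this variation up to sign and constant, Taylor's
   formula along x gives t' - t <= const * slope * (W(t') - W(t)) without any
   continuity of x, because W absorbs the jumps of x. The least slope on the
   level t is also, up to a factor 2, monotone in t near 0. Thus W itself is a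
   desingularizing function, and W(E(x_k) - l) telescopes in the length
   estimate. *)

(** * Alternations of sign conditions *)

Section Alternations.
Variable R : realType.

Fixpoint alts (T : eqType) (g : R -> T) (x : R) (s : seq R) : nat :=
  if s is y :: s' then ((g x != g y) + alts g y s')%N else 0%N.

Definition alts_bounded (T : eqType) (k : nat) (g : R -> T) : Prop :=
  forall x s, path <%R x s -> (alts g x s <= k)%N.

Lemma alts_boundedS (T : eqType) (k m : nat) (g : R -> T) : (k <= m)%N ->
  alts_bounded k g -> alts_bounded m g.
Proof. by move=> km gk x s /gk /leq_trans; apply. Qed.

Lemma alts_bounded_comb (T1 T2 T : eqType) k1 k2
    (g1 : R -> T1) (g2 : R -> T2) (g : R -> T) :
  (forall x y, x < y -> g1 x = g1 y -> g2 x = g2 y -> g x = g y) ->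
  alts_bounded k1 g1 -> alts_bounded k2 g2 -> alts_bounded (k1 + k2) g.
Proof.
move=> g12 gk1 gk2 x s xs; apply: leq_trans (leq_add (gk1 _ _ xs) (gk2 _ _ xs)).
elim: s x xs => //= y s IHs x /andP[xy /IHs ys]; rewrite addnACA leq_add //.
have [g1E|_] := eqVneq (g1 x) (g1 y); last by rewrite (leq_trans (leq_b1 _)).
have [g2E|_] := eqVneq (g2 x) (g2 y); last by rewrite (leq_trans (leq_b1 _)).
by rewrite (g12 _ _ xy g1E g2E) eqxx.
Qed.

Lemma alts_bounded_nondecreasing (g : R -> bool) :
  (forall x y, x < y -> g x -> g y) -> alts_bounded 1 g.
Proof.
move=> gle x s xs.
suff : (alts g x s + g x <= 1)%N by move/(leq_trans _); apply; rewrite leq_addr.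
elim: s x xs => //= [|y s IHs] x; first by rewrite add0n leq_b1.
case/andP=> xy /IHs; have := gle _ _ xy.
by case: (g x); case: (g y) => //= gxy; try (have := gxy isT); lia.
Qed.

Lemma alts_bounded_cst (T : eqType) k (g : R -> T) :
  (forall x y, g x = g y) -> alts_bounded k g.
Proof.
move=> gE x s _; suff -> : alts g x s = 0%N by [].
by elim: s x => //= y s IHs x; rewrite (gE x y) eqxx IHs.
Qed.

Lemma alts_bounded_sgr_horner (p : {poly R}) :
  alts_bounded (2 * size p) (fun t => Num.sg p.[t]).
Proof.
have [->|p0] := eqVneq p 0.
  by apply: alts_bounded_cst => x y; rewrite !horner0.
(* The position relative to the roots of p determines the sign of p. *)
suff alts_roots (r : seq R) : exists g : R -> seq (bool * bool),
    alts_bounded (2 * size r) g /\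
    (forall x y, g x = g y -> {in r, forall z,
      (z < x) = (z < y) /\ (z <= x) = (z <= y)}).
  have [g [gb gE]] := alts_roots (rootsR p).
  have rootsE z : root p z -> z \in rootsR p.
    by move=> pz; rewrite -roots_on_rootsR // inE pz.
  have sr : (size (rootsR p) < size p)%N.
    apply: max_poly_roots => //; last exact: uniq_roots.
    by apply/allP => z; rewrite -roots_on_rootsR // => /andP[].
  apply: (@alts_boundedS _ (2 * size (rootsR p) + 0)).
    by rewrite addn0 leq_mul2l ltnW.
  apply: (@alts_bounded_comb _ unit _ _ _ g (fun=> tt)) => //; last first.
    exact: alts_bounded_cst.
  move=> x y xy gxy _; have rxy := gE _ _ gxy.
  have nroot z : x <= z -> z <= y -> ~~ root p z.
    move=> xz zy; apply/negP => /rootsE/rxy[]; rewrite zy (ltNge z x) xz /= => zy' zx.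
    by move: zy'; rewrite (le_lt_trans zx xy).
  have px : p.[x] != 0 by apply: nroot; rewrite ?lexx ?ltW.
  have py : p.[y] != 0 by apply: nroot; rewrite ?lexx ?ltW.
  apply/eqP/negPn/negP => sgN.
  have [] := @polyrcf.poly_ivt _ p x y (ltW xy).
    move: sgN px py; rewrite -sgr_le0 sgrM.
    by case: sgrP; case: sgrP => // _ _; rewrite ?mulr1 ?mul1r ?mulrN1 ?eqxx //; lra.
  by move=> z /[!in_itv]/andP[xz zy]; apply/negP/nroot.
elim: r => [|z r [g [gb gE]]]; first by exists (fun=> [::]); split => //; exact: alts_bounded_cst.
exists (fun t => (z < t, z <= t) :: g t); split => [|x y [zx zy gxy] z']; last first.
  by rewrite inE => /orP[/eqP ->|/(gE _ _ gxy)].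
rewrite /= mulnS; apply: (@alts_bounded_comb _ _ _ _ _ (fun t => (z < t, z <= t)) g) => //.
  by move=> x y _ /= [-> ->] ->.
apply: (@alts_bounded_comb _ _ _ 1 1 (fun t => z < t) (fun t => z <= t)).
- by move=> x y _ /= -> ->.
- by apply: alts_bounded_nondecreasing => x y xy /lt_trans; apply.
- by apply: alts_bounded_nondecreasing => x y xy /le_trans; apply; exact: ltW.
Qed.

End Alternations.

(** * Tame behaviour of definable predicates *)

Section TameFormulas.
Variable R : realType.

Lemma eval_set_nth_horner (t : GRing.term R) : GRing.rterm t -> exists D : nat,
  forall e, exists2 p : {poly R}, (size p <= D)%N &
    forall x, GRing.eval (set_nth 0 e 0 x) t = p.[x].
Proof.
elim: t => //=.
- case=> [|n] _.
    by exists 2 => e; exists 'X => [|x]; rewrite ?size_polyX ?hornerX ?nth_set_nth.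
  by exists 1%N => e; exists (e`_n.+1)%:P => [|x]; rewrite ?size_polyC_leq1 ?hornerC ?nth_set_nth.
- by move=> c _; exists 1%N => e; exists c%:P => [|x]; rewrite ?size_polyC_leq1 ?hornerC.
- by move=> c _; exists 1%N => e; exists (c%:R)%:P => [|x]; rewrite ?size_polyC_leq1 ?hornerC.
- move=> t1 IH1 t2 IH2 /andP[/IH1[D1 H1] /IH2[D2 H2]].
  exists (maxn D1 D2) => e; have [p sp pE] := H1 e; have [q sq qE] := H2 e.
  exists (p + q) => [|x]; last by rewrite hornerD pE qE.
  by rewrite (leq_trans (size_polyD _ _)) // geq_max !leq_max sp sq orbT.
- move=> t IH /IH[D H]; exists D => e; have [p sp pE] := H e.
  by exists (- p) => [|x]; rewrite ?size_polyN ?hornerN ?pE.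
- move=> t IH n /IH[D H]; exists D => e; have [p sp pE] := H e.
  exists (p *+ n) => [|x]; last by rewrite hornerMn pE.
  by rewrite -scaler_nat (leq_trans (size_scale_leq _ _)).
- move=> t1 IH1 t2 IH2 /andP[/IH1[D1 H1] /IH2[D2 H2]].
  exists (D1 + D2)%N => e; have [p sp pE] := H1 e; have [q sq qE] := H2 e.
  exists (p * q) => [|x]; last by rewrite hornerM pE qE.
  by rewrite (leq_trans (size_polyMleq _ _)) // (leq_trans (leq_pred _)) // leq_add.
- move=> t IH n /IH[D H]; elim: n => [|n [D' H']].
    by exists 1%N => e; exists 1 => [|x]; rewrite ?size_poly1 ?hornerE ?expr0.
  exists (D + D')%N => e; have [p sp pE] := H e; have [q sq qE] := H' e.
  exists (p * q) => [|x]; last by rewrite hornerM exprS -pE -qE.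
  by rewrite (leq_trans (size_polyMleq _ _)) // (leq_trans (leq_pred _)) // leq_add.
Qed.

Lemma qf_eval_alts (f : ord.formula R) : ord.qf_form f && ord.rformula f ->
  exists k, forall e, alts_bounded k (fun t => ord.qf_eval (set_nth 0 e 0 t) f).
Proof.
have sg_alts (t1 t2 : GRing.term R) : GRing.rterm t1 -> GRing.rterm t2 ->
    exists k, forall e, alts_bounded k (fun t =>
      Num.sg (GRing.eval (set_nth 0 e 0 t) t1 - GRing.eval (set_nth 0 e 0 t) t2)).
  move=> r1 r2; have [|D H] := @eval_set_nth_horner (GRing.Add t1 (GRing.Opp t2)).
    by rewrite /= r1 r2.
  exists (2 * D)%N => e; have [p sp pE] := H e.
  apply: (@alts_boundedS _ _ (2 * size p)); first by rewrite leq_mul2l sp.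
  by have := alts_bounded_sgr_horner p; under eq_fun do rewrite -pE.
have atom (P : R -> bool) (t1 t2 : GRing.term R) : GRing.rterm t1 -> GRing.rterm t2 ->
    (forall x y, Num.sg x = Num.sg y -> P x = P y) ->
    exists k, forall e, alts_bounded k (fun t =>
      P (GRing.eval (set_nth 0 e 0 t) t1 - GRing.eval (set_nth 0 e 0 t) t2)).
  move=> r1 r2 PE; have [k H] := sg_alts _ _ r1 r2; exists k => e.
  rewrite -[k]addn0.
  apply: (alts_bounded_comb _ (H e) (@alts_bounded_cst _ _ 0 (fun=> tt) _)) => //.
  by move=> x y _ /PE.
elim: f => //=.
- by move=> b _; exists 0%N => e; apply: alts_bounded_cst.
- move=> t1 t2 /andP[r1 r2]; have [|k H] := atom (fun x => x == 0) _ _ r1 r2.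
    by move=> x y sE; rewrite -sgr_eq0 sE sgr_eq0.
  by exists k => e; have := H e; under eq_fun do rewrite subr_eq0.
- move=> t1 t2 /andP[r1 r2]; have [|k H] := atom (fun x => x < 0) _ _ r1 r2.
    by move=> x y sE; rewrite -sgr_lt0 sE sgr_lt0.
  by exists k => e; have := H e; under eq_fun do rewrite subr_lt0.
- move=> t1 t2 /andP[r1 r2]; have [|k H] := atom (fun x => x <= 0) _ _ r1 r2.
    by move=> x y sE; rewrite -sgr_le0 sE sgr_le0.
  by exists k => e; have := H e; under eq_fun do rewrite subr_le0.
- move=> f1 IH1 f2 IH2 /andP[/andP[q1 q2] /andP[r1 r2]].
  have [|k1 H1] := IH1; first by rewrite q1. have [|k2 H2] := IH2; first by rewrite q2.
  by exists (k1 + k2)%N => e; apply: alts_bounded_comb (H1 e) (H2 e) => x y _ /= -> ->.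
- move=> f1 IH1 f2 IH2 /andP[/andP[q1 q2] /andP[r1 r2]].
  have [|k1 H1] := IH1; first by rewrite q1. have [|k2 H2] := IH2; first by rewrite q2.
  by exists (k1 + k2)%N => e; apply: alts_bounded_comb (H1 e) (H2 e) => x y _ /= -> ->.
- move=> f1 IH1 f2 IH2 /andP[/andP[q1 q2] /andP[r1 r2]].
  have [|k1 H1] := IH1; first by rewrite q1. have [|k2 H2] := IH2; first by rewrite q2.
  by exists (k1 + k2)%N => e; apply: alts_bounded_comb (H1 e) (H2 e) => x y _ /= -> ->.
- move=> f IH /IH[k H]; exists k => e; rewrite -[k]addn0.
  by apply: (alts_bounded_comb _ (H e) (@alts_bounded_cst _ _ 0 (fun=> tt) _)) => // x y _ /= ->.
Qed.

Definition definable (P : seq R -> Prop) : Prop :=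
  exists f : ord.formula R, forall e, P e <-> ord.holds e f.

Lemma definable_alts (P : seq R -> Prop) : definable P ->
  exists k, forall e, alts_bounded k (fun t => `[< P (set_nth 0 e 0 t) >]).
Proof.
case=> f fP; pose g := ord.quantifier_elim (@wproj R) (ord.to_rform f).
have [|k H] := @qf_eval_alts g.
  exact: (ord.quantifier_elim_wf (@wf_QE_wproj R)) (ord.to_rform_rformula f).
exists k => e; have := H e; congr alts_bounded; apply/funext => t.
apply/esym/asbool_equiv_eqP; last exact: fP.
exact: (@rcf_satP R).
Qed.

Lemma definable_germ (P : seq R -> Prop) e : definable P ->
  exists2 eps, 0 < eps & (forall t, 0 < t < eps -> P (set_nth 0 e 0 t)) \/
                         (forall t, 0 < t < eps -> ~ P (set_nth 0 e 0 t)).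
Proof.
move=> /definable_alts[k /(_ e)]; set g := fun t => _ => gk.
apply: contrapT => noeps.
have vary x : 0 < x -> exists2 y, 0 < y < x & g y != g x.
  move=> x0; apply: contrapT => novary; apply: noeps; exists x => //.
  have gE y : 0 < y < x -> g y = g x.
    by move=> yx; apply/eqP/negPn/negP => gxy; apply: novary; exists y.
  by case gx: (g x); [left|right] => t /gE; rewrite gx => /asboolP.
have long m : exists x s, [/\ 0 < x, path <%R x s & (m <= alts g x s)%N].
  elim: m => [|m [x [s [x0 xs mle]]]]; first by exists 1, [::]; split.
  have [y /andP[y0 yx] gyx] := vary x x0.
  by exists y, (x :: s); split=> //=; rewrite ?yx ?gyx.
by have [x [s [_ /gk]]] := long k.+1; rewrite leqNgt => /negP.
Qed.

End TameFormulas.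

(** * Bounded variation from uniformly bounded alternations *)

Section BoundedVariation.
Variable R : realType.
Implicit Types (u : R -> R) (a b c h v w A : R).

Lemma grid_count c h n v : 0 <= h -> c <= v -> v <= c + n%:R * h ->
  v - c <= h * (\sum_(j < n) (c + j%:R * h < v)%R)%:R <= v - c + h.
Proof.
move=> h0 cv; elim: n => [|n IHn].
  by rewrite mul0r addr0 big_ord0 mulr0 => vc; apply/andP; split; lra.
have [vn _|nv vn1] := leP v (c + n%:R * h).
  by rewrite big_ord_recr /= ltNge vn addn0 IHn.
have -> : (\sum_(j < n.+1) (c + j%:R * h < v)%R)%N = n.+1.
  rewrite -[RHS]card_ord -sum1_card; apply: eq_bigr => j _.
  suff -> : (c + j%:R * h < v) by [].
  by rewrite (le_lt_trans _ nv) // lerD2l ler_wpM2r // ler_nat -ltnS.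
by move: vn1; rewrite -natr1 => vn1; apply/andP; split; lra.
Qed.

Lemma grid_dist c h n v w : 0 <= h -> c <= v -> v <= c + n%:R * h ->
  c <= w -> w <= c + n%:R * h ->
  `|v - w| <= h * (\sum_(j < n) ((c + j%:R * h < v)%R != (c + j%:R * h < w)%R))%:R + h.
Proof.
move=> h0 cv vn cw wn; have /andP[v1 v2] := grid_count h0 cv vn.
have /andP[w1 w2] := grid_count h0 cw wn.
set Nv := (\sum_(j < n) _)%N in v1 v2; set Nw := (\sum_(j < n) _)%N in w1 w2.
have le1 : (Nv <= Nw + \sum_(j < n) ((c + j%:R * h < v)%R != (c + j%:R * h < w)%R))%N.
  by rewrite -big_split leq_sum // => j _; case: (_ < v); case: (_ < w).
have le2 : (Nw <= Nv + \sum_(j < n) ((c + j%:R * h < v)%R != (c + j%:R * h < w)%R))%N.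
  by rewrite -big_split leq_sum // => j _; case: (_ < v); case: (_ < w).
move: le1 le2; set D := (\sum_(j < n) _)%N.
rewrite -!(ler_nat R) !natrD => /(ler_wpM2l h0) le1 /(ler_wpM2l h0) le2.
by move: le1 le2; rewrite !mulrDr ler_norml => le1 le2; apply/andP; split; lra.
Qed.

Lemma le_last_path (x : R) s : path <%R x s -> x <= last x s.
Proof. by elim: s x => //= y s IHs x /andP[xy /IHs]; apply: le_trans; exact: ltW. Qed.

(* |u x - u y| is estimated by counting the levels of a grid of mesh 2 A / n
   that separate u x from u y; then n tends to infinity. *)
Lemma alts_variation u a b A k : 0 <= A ->
  (forall t, a <= t <= b -> `|u t| <= A) ->
  (forall c x s, path <%R x s -> a <= x -> last x s <= b ->
     (alts (fun t => (c < u t)%R) x s <= k)%N) ->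
  forall s, itv_partition a b s -> variation a b u s <= 2 * A * k%:R.
Proof.
move=> A0 uA uk s abs; rewrite variation_zip //.
have [pas /eqP lasb] := abs.
suff bound n : (0 < n)%N ->
    \sum_(x <- zip s (a :: s)) `|u x.1 - u x.2| <=
    2 * A * k%:R + 2 * A / n%:R * (size s)%:R.
  apply/ler_addgt0Pl => e e0.
  pose n := (Num.truncn (2 * A * (size s)%:R / e)).+1.
  apply: (le_trans (bound n _)) => //; rewrite addrC lerD2r.
  rewrite mulrAC ler_pdivrMr ?ltr0n // [e * _]mulrC -ler_pdivrMr //.
  rewrite /n ltW //; exact: truncnS_gt.
move=> n0; set h := 2 * A / n%:R.
have h0 : 0 <= h by rewrite divr_ge0 ?mulr_ge0 ?ler0n.
have nh : n%:R * h = 2 * A by rewrite mulrC divfK // pnatr_eq0 -lt0n.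
have uE t : a <= t <= b -> - A <= u t /\ u t <= - A + n%:R * h.
  by move=> /uA; rewrite nh ler_norml => /andP[? ?]; split; lra.
suff : \sum_(x <- zip s (a :: s)) `|u x.1 - u x.2| <=
    h * (\sum_(j < n) alts (fun t => - A + j%:R * h < u t)%R a s)%:R + h * (size s)%:R.
  move/le_trans; apply; rewrite lerD2r.
  have -> : 2 * A * k%:R = h * (n * k)%:R by rewrite -nh natrM; ring.
  apply: ler_wpM2l => //.
  rewrite ler_nat -[n in (n * k)%N]card_ord -sum_nat_const leq_sum // => j _.
  by apply: uk => //; rewrite lasb.
suff gen x s' : a <= x -> last x s' <= b -> path <%R x s' ->
    \sum_(x <- zip s' (x :: s')) `|u x.1 - u x.2| <=
    h * (\sum_(j < n) alts (fun t => - A + j%:R * h < u t)%R x s')%:R +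
    h * (size s')%:R.
  by apply: gen => //; rewrite lasb.
elim: s' x => [|y s' IHs] x ax /= {lasb} las.
  by rewrite big_nil addr_ge0 // mulr_ge0.
case/andP=> xy ys; rewrite big_cons /= big_split natrD mulrDr -natr1 mulrDr mulr1.
have yb := le_trans (le_last_path ys) las.
have ay : a <= y by rewrite (le_trans ax) // ltW.
have := IHs y ay las ys.
have xE := uE x; have yE := uE y; rewrite ax (le_trans (ltW xy) yb) in xE; rewrite ay yb in yE.
have [x1 x2] := xE isT; have [y1 y2] := yE isT.
have := grid_dist h0 x1 x2 y1 y2; rewrite distrC.
by move=> ? ?; lra.
Qed.

Lemma alts_total_variation u a b A k : 0 <= A ->
  (forall t, a <= t <= b -> `|u t| <= A) ->
  (forall c x s, path <%R x s -> a <= x -> last x s <= b ->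
     (alts (fun t => (c < u t)%R) x s <= k)%N) ->
  (total_variation a b u <= (2 * A * k%:R)%:E)%E.
Proof.
move=> A0 uA uk; apply: ge_ereal_sup => _ [_ [s abs <-] <-].
by rewrite lee_fin; apply: alts_variation abs.
Qed.

End BoundedVariation.

(** * Definable predicates *)

Section Definability.
Variable R : realType.
Implicit Types (P Q : seq R -> Prop) (g h : seq R -> R) (e : seq R).

Definition term_fun g : Prop := exists t : GRing.term R, forall e, g e = GRing.eval e t.

Lemma term_fun_var i : term_fun (fun e => e`_i).
Proof. by exists (GRing.Var R i). Qed.

Lemma term_fun_cst c : term_fun (fun=> c).
Proof. by exists (GRing.Const c). Qed.

Lemma term_funD g h : term_fun g -> term_fun h -> term_fun (fun e => g e + h e).
Proof. by move=> [t tE] [u uE]; exists (GRing.Add t u) => e /=; rewrite tE uE. Qed.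

Lemma term_funM g h : term_fun g -> term_fun h -> term_fun (fun e => g e * h e).
Proof. by move=> [t tE] [u uE]; exists (GRing.Mul t u) => e /=; rewrite tE uE. Qed.

Lemma definable_le g h : term_fun g -> term_fun h -> definable (fun e => g e <= h e).
Proof. by move=> [t tE] [u uE]; exists (ord.Le t u) => e /=; rewrite tE uE. Qed.

Lemma definable_lt g h : term_fun g -> term_fun h -> definable (fun e => g e < h e).
Proof. by move=> [t tE] [u uE]; exists (ord.Lt t u) => e /=; rewrite tE uE. Qed.

Lemma definable_eq g h : term_fun g -> term_fun h -> definable (fun e => g e = h e).
Proof. by move=> [t tE] [u uE]; exists (ord.Equal t u) => e /=; rewrite tE uE. Qed.

Lemma definable_and P Q : definable P -> definable Q -> definable (fun e => P e /\ Q e).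
Proof. by move=> [f fP] [g gQ]; exists (ord.And f g) => e /=; rewrite fP gQ. Qed.

Lemma definable_imp P Q : definable P -> definable Q -> definable (fun e => P e -> Q e).
Proof. by move=> [f fP] [g gQ]; exists (ord.Implies f g) => e /=; rewrite fP gQ. Qed.

Lemma definable_not P : definable P -> definable (fun e => ~ P e).
Proof. by move=> [f fP]; exists (ord.Not f) => e /=; rewrite fP. Qed.

Lemma definable_iff P Q : (forall e, P e <-> Q e) -> definable P -> definable Q.
Proof. by move=> PQ [f fP]; exists f => e; rewrite -PQ. Qed.

Lemma definable_all m (P : nat -> seq R -> Prop) : (forall i, definable (P i)) ->
  definable (fun e => forall i, (i < m)%N -> P i e).
Proof.
move=> dP; elim: m => [|m IHm]; first by exists (ord.Bool true).
apply: (definable_iff _ (definable_and IHm (dP m))) => e; split.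
  by move=> [H Pm] i; rewrite ltnS leq_eqVlt => /orP[/eqP ->//|/H].
by move=> H; split=> [i im|]; apply: H => //; rewrite ltnW.
Qed.

Definition agree_below (o : nat) e e' := forall j, (j < o)%N -> e`_j = e'`_j.

Lemma definable_ex_below o n P : definable P -> definable (fun e =>
  exists e', (forall j, ~~ (o <= j < o + n)%N -> e`_j = e'`_j) /\ P e').
Proof.
move=> [f fP]; elim: n => [|n [g gP]].
  exists f => e; rewrite -fP; split=> [[e' [ee' /fP f_e']]|Pe]; last by exists e.
  apply/fP; apply: ord.eq_holds f_e' => j; rewrite ee' //.
  by rewrite addn0 leqNgt andNb.
exists (ord.Exists (o + n) g) => e /=; split.
  move=> [e' [ee' Pe']]; exists e'`_(o + n); apply/gP; exists e'; split => // j.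
  rewrite nth_set_nth /=; case: eqVneq => [->//|jn] jo; apply: ee'.
  by apply: contra jo => /andP[->]; rewrite addnS ltnS leq_eqVlt (negPf jn).
move=> [x /gP[e' [ee' Pe']]]; exists e'; split => // j jo.
have := ee' j; rewrite nth_set_nth /=; case: eqVneq => [jE|jn].
  by move: jo; rewrite jE leq_addr addnS ltnSn.
by apply; apply: contra jo => /andP[-> jn']; rewrite addnS ltnS ltnW.
Qed.

Definition block n (o : nat) e : 'rV[R]_n := \row_i e`_(o + i).

Lemma block_agree n o e e' : agree_below (o + n) e e' -> block n o e = block n o e'.
Proof. by move=> ee'; apply/rowP => i; rewrite !mxE ee' // ltn_add2l. Qed.

Lemma block_surj n o (v : 'rV[R]_n) e : exists e',
  (forall j, ~~ (o <= j < o + n)%N -> e`_j = e'`_j) /\ block n o e' = v.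
Proof.
pose F j := if (o <= j)%N then
  (if insub (j - o)%N is Some i then v 0 i else e`_j) else e`_j.
exists (mkseq F (size e + (o + n))); split=> [j jo|].
  have [js|js] := ltnP j (size e + (o + n)); last first.
    by rewrite !nth_default ?size_mkseq // (leq_trans _ js) // leq_addr.
  rewrite nth_mkseq // /F; case: ifP => // oj; case: insubP => // i.
  by rewrite oj /= -leqNgt in jo; lia.
apply/rowP => i; rewrite mxE nth_mkseq; last by apply: ltn_addl; rewrite ltn_add2l ltn_ord.
by rewrite /F leq_addr addKn valK.
Qed.

Lemma definable_ex_block n o (Q : 'rV[R]_n -> seq R -> Prop) :
  (forall v e e', agree_below o e e' -> Q v e -> Q v e') ->
  definable (fun e => Q (block n o e) e) -> definable (fun e => exists v, Q v e).
Proof.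
move=> Qo /(@definable_ex_below o n); apply: definable_iff => e; split.
  move=> [e' [ee' Qe']]; exists (block n o e'); apply: Qo Qe' => j jo.
  by rewrite ee' // leqNgt jo.
move=> [v Qv]; have [e' [ee' vE]] := block_surj o v e.
exists e'; split=> //; rewrite vE; apply: Qo Qv => j jo.
by rewrite ee' // leqNgt jo.
Qed.

Lemma definable_all_block n o (Q : 'rV[R]_n -> seq R -> Prop) :
  (forall v e e', agree_below o e e' -> Q v e -> Q v e') ->
  definable (fun e => Q (block n o e) e) -> definable (fun e => forall v, Q v e).
Proof.
move=> Qo dQ.
have : definable (fun e => ~ exists v, ~ Q v e).
  apply/definable_not/(@definable_ex_block n o); last exact: definable_not.
  move=> v e e' ee' nQ /Qo Qe; apply: nQ; apply: Qe => j jo.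
  by rewrite ee'.
apply: definable_iff => e; split=> [H v|H [v]]; last exact.
by apply: contrapT => nQ; apply: H; exists v.
Qed.

Lemma definable_all_var i (Q : R -> seq R -> Prop) :
  (forall x e e', agree_below i e e' -> Q x e -> Q x e') ->
  definable (fun e => Q e`_i e) -> definable (fun e => forall x, Q x e).
Proof.
move=> Qo [f fP]; exists (ord.Forall i f) => e /=.
have ag x : agree_below i e (set_nth 0 e i x).
  by move=> j ji; rewrite nth_set_nth /= ltn_eqF.
have ag' x : agree_below i (set_nth 0 e i x) e by move=> j /(ag x).
split=> [H x|H x].
  by apply/fP; rewrite nth_set_nth /= eqxx; apply: Qo (H x).
by apply: (Qo _ _ _ (ag' x)); move/fP: (H x); rewrite nth_set_nth /= eqxx.
Qed.

End Definability.

(** * Lexicographic minima and chaining *)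

Section Lexicographic.
Variables (R : realType) (T : topologicalType) (q : nat -> T -> R).

Definition lex_le (m : nat) (v w : T) : Prop := forall i, (i < m)%N ->
  (forall j, (j < i)%N -> q j v = q j w) -> q i v <= q i w.

Lemma lex_le_anti m v w : lex_le m v w -> lex_le m w v ->
  forall i, (i < m)%N -> q i v = q i w.
Proof.
move=> vw wv; elim/ltn_ind => i IH im.
have IH' j : (j < i)%N -> q j v = q j w by move=> ji; apply: IH => //; apply: ltn_trans im.
apply/eqP; rewrite eq_le; apply/andP; split; first exact: vw.
by apply: wv => // j /IH'.
Qed.

Lemma lex_min_exists m (K : set T) : (forall i, continuous (q i)) ->
  compact K -> K !=set0 -> exists2 v, K v & forall w, K w -> lex_le m v w.
Proof.
move=> qc Kc K0; suff [L [Lc [v Lv] LK Lmin]] : exists L : set T,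
    [/\ compact L, L !=set0, L `<=` K & forall v w, L v -> K w ->
      lex_le m v w /\ ((forall j, (j < m)%N -> q j v = q j w) -> L w)].
  by exists v => [|w Kw]; [exact: LK | case: (Lmin v w Lv Kw)].
elim: m => [|m [L [Lc L0 LK Lmin]]]; first by exists K; split.
have [v] := compact_EVT_min L0 Lc (continuous_subspaceT (qc m)).
rewrite inE => Lv vmin; exists (L `&` [set w | q m w <= q m v]); split.
- apply: compact_closedI => //.
  by apply: (@closed_comp _ _ (q m) [set x | x <= q m v]) => [x _|]; [exact: qc|exact: closed_le].
- by exists v; split => /=.
- by move=> w [/LK].
move=> x w [Lx /= xv] Kw; have [xw Lw] := Lmin x w Lx Kw; split.
  move=> i; rewrite ltnS leq_eqVlt => /orP[/eqP ->|im]; last exact: xw.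
  by move=> /Lw {}Lw; rewrite (le_trans xv) // vmin // inE.
move=> H; split; first by apply: Lw => j jm; apply: H; rewrite ltnW.
by rewrite /= -(H m).
Qed.

End Lexicographic.

Section Chain.
Variable R : realType.

Lemma chain_increment (V : R -> R) (K w a b : R) : 0 < w -> a <= b ->
  (forall s t, a <= s -> s <= t -> t <= b -> t - s <= w -> t - s <= K * (V t - V s)) ->
  b - a <= K * (V b - V a).
Proof.
move=> w0 ab Hw.
have [m mP] : exists m : nat, b - a <= m%:R * w.
  exists (Num.truncn ((b - a) / w)).+1; rewrite -ler_pdivrMr // ltW //.
  exact: truncnS_gt.
elim: m b mP ab Hw => [|m IHm] b; first by rewrite mul0r => ba ab Hw; apply: Hw; lra.
rewrite -natr1 mulrDl mul1r => ba ab Hw; have [?|wba] := leP (b - a) w; first by apply: Hw; lra.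
have := IHm (b - w); have := Hw (b - w) b => H1 H2.
have {}H1 : b - (b - w) <= K * (V b - V (b - w)) by apply: H1; lra.
have {}H2 : b - w - a <= K * (V (b - w) - V a).
  by apply: H2 => [||s t ? ? ? ?]; [lra|lra|apply: Hw => //; lra].
by lra.
Qed.

End Chain.

(** * The Kurdyka-Lojasiewicz inequality on a box *)

Section KurdykaLojasiewicz.
Variables (R : realType) (n : nat).
Local Notation V := 'rV[R]_n.
Implicit Types (f S : V -> R) (v w x y : V) (s t A : R).

Definition term_block_fun f : Prop := forall o, term_fun (fun e => f (block n o e)).

Definition norm1 v : R := \sum_i `|v 0 i|.

Definition box A : set V := [set v | forall i, `|v 0 i| <= A].

Lemma box_compact A : compact (box A).
Proof.
have -> : box A = [set v | forall i, `[- A, A]%classic (v ord0 i)].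
  by apply/seteqP; split=> v vA i; have := vA i; rewrite /= in_itv /= ler_norml.
apply: (@rV_compact R n (fun=> `[- A, A]%classic)) => i; exact: segment_compact.
Qed.

Lemma term_block_coord i : term_block_fun (fun v => v 0 i).
Proof.
move=> o; have [t tE] := term_fun_var R (o + i).
by exists t => e; rewrite mxE tE.
Qed.

Lemma definable_box A o : definable (fun e => box A (block n o e)).
Proof.
pose c i v : R := if insub i is Some j then v 0 (j : 'I_n) else 0.
have ct i : term_fun (fun e => c i (block n o e)).
  rewrite /c; case: insubP => [j _ _|_]; [exact: term_block_coord|exact: term_fun_cst].
have := @definable_all R n (fun i e => - A <= c i (block n o e) /\ c i (block n o e) <= A).
move/(_ (fun i => definable_and (definable_le (term_fun_cst _) (ct i))
                                (definable_le (ct i) (term_fun_cst _)))).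
apply: definable_iff => e; split=> [H i|H i ilt].
  by rewrite ler_norml; apply/andP; have := H i (ltn_ord i); rewrite /c valK.
by have := H (Ordinal ilt); rewrite ler_norml /c insubT => /andP.
Qed.

Section Level.
Variables (f S : V -> R) (A : R).
Hypotheses (f_term : term_block_fun f) (S_term : term_block_fun S).
Hypotheses (f_cont : continuous f) (S_cont : continuous S).
Hypotheses (S_ge0 : forall v, 0 <= S v) (A_ge0 : 0 <= A).

Definition level t : set V := [set v | box A v /\ f v = t].

(* With S as first key the lexicographic minimum has least slope; the
   coordinates make it unique. Keys beyond the dimension are 0. *)
Definition keys (i : nat) : V -> R :=
  if i is j.+1 then (fun v => if insub j is Some k then v 0 (k : 'I_n) else 0) else S.

Definition talweg t v : Prop := level t v /\ forall w, level t w -> lex_le keys n.+1 v w.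

Lemma keys_term i : term_block_fun (keys i).
Proof.
case: i => [|i] //=; case: insubP => [j _ _|_] o; first exact: term_block_coord.
exact: term_fun_cst.
Qed.

Lemma keys_cont i : continuous (keys i).
Proof.
case: i => [|i] //=; case: insubP => [j _ _|_] x; first exact: coord_continuous.
exact: cst_continuous.
Qed.

Lemma talweg_unique t v w : talweg t v -> talweg t w -> v = w.
Proof.
move=> [lv vmin] [lw wmin]; apply/rowP => i.
have := lex_le_anti (vmin w lw) (wmin v lv) (i := i.+1).
by rewrite ltnS ltn_ord /= valK; apply.
Qed.

Lemma talweg_exists t : level t !=set0 -> exists v, talweg t v.
Proof.
move=> lt0; have [|v] := @lex_min_exists _ _ keys n.+1 _ keys_cont _ lt0.
  apply: compact_closedI; first exact: box_compact.
  apply: (@preimage_closed _ _ f [set y | y = t]) => [x _|]; [exact: f_cont|exact: closed_eq].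
by move=> lv vmin; exists v; split.
Qed.

Lemma talweg_min t v w : talweg t v -> level t w -> S v <= S w.
Proof. by move=> [_ vmin] /vmin /(_ 0%N); apply. Qed.

Lemma definable_level (g : seq R -> R) o : term_fun g ->
  definable (fun e => level (g e) (block n o e)).
Proof. by move=> gt; apply: definable_and; [exact: definable_box|exact: definable_eq]. Qed.

Lemma definable_lex_le o o' : definable (fun e =>
  lex_le keys n.+1 (block n o e) (block n o' e)).
Proof.
apply: definable_all => i; apply: definable_imp.
  by apply: definable_all => j; apply: definable_eq; exact: keys_term.
by apply: definable_le; exact: keys_term.
Qed.

Lemma definable_nonempty_level : definable (fun e => level e`_0 !=set0).
Proof.
apply: (@definable_ex_block _ n 1 (fun v e => level e`_0 v)).
  by move=> v e e' ee'; rewrite (ee' 0%N).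
by apply: definable_level; exact: term_fun_var.
Qed.

Lemma definable_talweg_coord (i : 'I_n) :
  definable (fun e => exists v, talweg e`_0 v /\ e`_1 < v 0 i).
Proof.
apply: (@definable_ex_block _ n 2 (fun v e => talweg e`_0 v /\ e`_1 < v 0 i)).
  by move=> v e e' ee'; rewrite (ee' 0%N) // (ee' 1%N).
apply: definable_and; last first.
  by apply: definable_lt; [exact: term_fun_var|exact: term_block_coord].
apply: definable_and; first by apply: definable_level; exact: term_fun_var.
apply: (@definable_all_block _ n (2 + n)
  (fun w e => level e`_0 w -> lex_le keys n.+1 (block n 2 e) w)).
  by move=> v e e' ee'; rewrite (ee' 0%N) // (block_agree ee').
apply: definable_imp; last exact: definable_lex_le.
by apply: definable_level; exact: term_fun_var.
Qed.

(* S is a squared slope, so 4 is a factor 2 for the slope. Any factor above 1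
   makes near-suprema of S satisfy the condition, whether or not S has maxima. *)
Definition almost_record t : Prop := forall s, 0 < s < t ->
  forall y, level t y -> exists x, level s x /\ S x <= 4 * S y.

Lemma definable_almost_record : definable (fun e => almost_record e`_0).
Proof.
apply: (@definable_all_var _ 1 (fun s e => 0 < s < e`_0 ->
  forall y, level e`_0 y -> exists x, level s x /\ S x <= 4 * S y)).
  by move=> s e e' ee'; rewrite (ee' 0%N).
have e0 := term_fun_var R 0; have e1 := term_fun_var R 1.
apply: definable_imp.
  apply: (definable_iff _ (definable_and (definable_lt (term_fun_cst 0) e1)
                                         (definable_lt e1 e0))).
  by move=> e; split=> /andP.
apply: (@definable_all_block _ n 2 (fun y e => level e`_0 y ->
  exists x, level e`_1 x /\ S x <= 4 * S y)).
  by move=> v e e' ee'; rewrite (ee' 0%N) // (ee' 1%N).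
apply: definable_imp; first exact: definable_level.
apply: (@definable_ex_block _ n (2 + n) (fun x e =>
  level e`_1 x /\ S x <= 4 * S (block n 2 e))).
  by move=> v e e' ee'; rewrite (ee' 1%N) // (block_agree ee').
apply: definable_and; first exact: definable_level.
apply: definable_le; first exact: S_term.
by apply: term_funM; [exact: term_fun_cst|exact: S_term].
Qed.

Lemma talweg_alts (i : 'I_n) : exists k, forall c, alts_bounded k
  (fun t => `[< exists v, talweg t v /\ c < v 0 i >]).
Proof.
have [k H] := definable_alts (definable_talweg_coord i).
by exists k => c; have := H [:: 0; c].
Qed.

Lemma exists_almost_record eps : 0 < eps ->
  (forall t, 0 < t < eps -> level t !=set0) ->
  exists2 t, 0 < t < eps & almost_record t.
Proof.
move=> eps0 lne.
have [|M _ M_max] := compact_EVT_max _ (@box_compact A) (continuous_subspaceT S_cont).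
  by exists 0 => i; rewrite mxE normr0.
pose D := [set z | exists2 t, 0 < t < eps & exists2 v, talweg t v & z = S v].
have t0P : 0 < eps / 2 < eps by apply/andP; split; lra.
have [v0 tv0] := talweg_exists (lne _ t0P).
have Dsup : has_sup D.
  split; first by exists (S v0); exists (eps / 2) => //; exists v0.
  exists (S M) => _ [t _ [v [[bv _] _] ->]]; apply: M_max; exact/mem_set.
have S_le t v : 0 < t < eps -> talweg t v -> S v <= sup D.
  by move=> te tv; apply: sup_upper_bound => //; exists t => //; exists v.
have [s sP [v tv supD]] : exists2 s, 0 < s < eps & exists2 v, talweg s v & sup D <= 4 * S v.
  have := S_le _ _ t0P tv0; have := S_ge0 v0; rewrite le_eqVlt => /orP[/eqP v00|v0_gt0] v0D.
    have [D0|D0] := leP (sup D) 0.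
      by exists (eps / 2) => //; exists v0 => //; rewrite -v00; lra.
    have [_ [s sP [v tv ->]] ltv] := sup_adherent (divr_gt0 D0 (ltr0n _ 2)) Dsup.
    by exists s => //; exists v => //; lra.
  have D0 : 0 < sup D by lra.
  have [_ [s sP [v tv ->]] ltv] := sup_adherent (divr_gt0 D0 (ltr0n _ 2)) Dsup.
  by exists s => //; exists v => //; lra.
have /andP[s0 se] := sP; exists s => // s' /andP[s'0 s's] y ly.
have s'P : 0 < s' < eps by rewrite s'0 (lt_trans s's).
have [x tx] := talweg_exists (lne _ s'P); exists x; split; first by case: tx.
by have := S_le _ _ s'P tx; have := talweg_min tv ly; lra.
Qed.

(* No continuity of x is needed: a jump norm1 (x t - x s) > e / C bounds
   W t - W s from below, so the estimate holds once t - s is small. *)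
Lemma level_slope_bound (C t1 t2 K : R) (x : R -> V) (W : R -> R) :
  0 < C -> 0 <= K -> t1 <= t2 ->
  (forall v w, box A v -> box A w -> f w - f v <=
     C * (Num.sqrt (S v) * norm1 (w - v) + norm1 (w - v) ^+ 2)) ->
  (forall t, t1 <= t <= t2 -> level t (x t) /\ Num.sqrt (S (x t)) <= K) ->
  (forall s t, t1 <= s -> s <= t -> t <= t2 -> norm1 (x t - x s) <= W t - W s) ->
  t2 - t1 <= C * K * (W t2 - W t1).
Proof.
move=> C0 K0 t12 fC xK xW.
have norm1_ge0 v : 0 <= norm1 v by apply: sumr_ge0.
have W12 : 0 <= W t2 - W t1 by apply: le_trans (xW t1 t2 _ _ _).
suff chain e : 0 < e -> t2 - t1 <= (C * K + e) * (W t2 - W t1).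
  apply/ler_addgt0Pl => e e0.
  have We0 : 0 < W t2 - W t1 + 1 by lra.
  apply: le_trans (chain (e / (W t2 - W t1 + 1)) (divr_gt0 e0 We0)) _.
  rewrite mulrDl addrC lerD2r mulrAC ler_pdivrMr // ler_pM2l //; lra.
move=> e0; have CKe : 0 < C * K + e by rewrite ltr_wpDl // mulr_ge0 // ltW.
apply: (@chain_increment _ W _ ((C * K + e) * (e / C))) => //.
  by rewrite mulr_gt0 // divr_gt0.
move=> s t t1s st tt2 tsw.
have [|[bs fs] Ks] := xK s; first by rewrite t1s (le_trans st).
have [|[bt ft] Kt] := xK t; first by rewrite tt2 (le_trans t1s).
have := fC _ _ bs bt; have := xW s t t1s st tt2; rewrite fs ft.
have := norm1_ge0 (x t - x s); set D := norm1 _ => D0 DW fD.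
have [De|eD] := leP D (e / C); last first.
  apply: (le_trans tsw); rewrite ler_pM2l //; lra.
apply: (@le_trans _ _ ((C * K + e) * D)); last by rewrite ler_pM2l.
apply: (le_trans fD); rewrite mulrDr mulrDl lerD //.
  by rewrite -mulrA ler_pM2l // ler_wpM2r.
by rewrite expr2 mulrA ler_wpM2r // mulrC -ler_pdivlMr.
Qed.

Theorem kurdyka_lojasiewicz (C : R) : 0 < C ->
  (forall v w, box A v -> box A w -> f w - f v <=
     C * (Num.sqrt (S v) * norm1 (w - v) + norm1 (w - v) ^+ 2)) ->
  exists eps (W : R -> R) L, [/\ 0 < eps,
    forall t, 0 < t < eps -> `|W t| <= L,
    forall s t, 0 < s -> s <= t -> t < eps -> W s <= W t &
    forall x t, box A x -> 0 < t -> t <= f x -> f x < eps ->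
      f x - t <= 2 * C * Num.sqrt (S x) * (W (f x) - W t)].
Proof.
move=> C0 fC.
have [eps0 eps0_gt0 [lne|lemp]] := definable_germ [::] definable_nonempty_level;
  last first.
  exists eps0, (fun=> 0), 0; split=> //; first by rewrite normr0.
  move=> x t bx t0 tx xe; exfalso; apply: (lemp (f x)); last by exists x.
  by rewrite xe (lt_le_trans t0).
rewrite /= in lne.
have /choice[X XP] : forall t, exists v, 0 < t < eps0 -> talweg t v.
  move=> t; have [tP|] := boolP (0 < t < eps0); last by exists 0.
  by have [v ?] := talweg_exists (lne t tP); exists v.
have /choice[k kP] := talweg_alts.
pose eps1 := eps0 / 2; have eps1_gt0 : 0 < eps1 by rewrite divr_gt0.
have eps10 : eps1 < eps0 by rewrite /eps1; lra.
have TVk i a b : 0 < a -> a <= b -> b <= eps1 ->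
    (total_variation a b (fun t => X t 0%R i) <= (2 * A * (k i)%:R)%:E)%E.
  move=> a0 ab be; apply: alts_total_variation => //.
    move=> t /andP[at_ tb]; have [|[bX _] _] := XP t; last exact: bX.
    by rewrite (lt_le_trans a0) // (le_lt_trans tb) // (le_lt_trans be).
  move=> c x s xs ax lb.
  have := kP i c x s xs; suff -> : alts (fun t => `[< exists v, talweg t v /\ c < v 0 i >]) x s =
    alts (fun t => (c < X t 0 i)%R) x s by [].
  have XE t : a <= t -> t <= b ->
      `[< exists v, talweg t v /\ c < v 0 i >] = (c < X t 0 i)%R.
    move=> at_ tb; have tX : talweg t (X t).
      by apply: XP; rewrite (lt_le_trans a0) // (le_lt_trans tb) // (le_lt_trans be).
    apply/asboolP/idP => [[v [tv cv]]|cX]; last by exists (X t).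
    by rewrite (talweg_unique tX tv).
  elim: s x xs ax lb => //= y s IHs x /andP[xy ys] ax lb.
  have ay : a <= y by rewrite (le_trans ax) // ltW.
  have yb := le_trans (le_last_path ys) lb.
  by rewrite (IHs y) // !XE // (le_trans (ltW xy)).
have TVfin i a b : 0 < a -> a <= b -> b <= eps1 ->
    total_variation a b (fun t => X t 0%R i) \is a fin_num.
  move=> a0 ab be; rewrite ge0_fin_numE ?total_variation_ge0 //.
  by rewrite (le_lt_trans (TVk i a b a0 ab be)) // ltry.
pose W t := - \sum_i fine (total_variation t eps1 (fun t => X t 0%R i)).
have XW s t : 0 < s -> s <= t -> t <= eps1 -> norm1 (X t - X s) <= W t - W s.
  move=> s0 st te; have t0 := lt_le_trans s0 st.
  rewrite /W opprK [leRHS]addrC -sumrB; apply: ler_sum => i _; rewrite !mxE.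
  rewrite (total_variationD _ st te) fineD ?TVfin // addrK.
  rewrite -lee_fin fineK ?TVfin //; exact: total_variation_ge.
have [eps2 eps2_gt0 rec] := definable_germ [::] definable_almost_record.
rewrite /= in rec.
have {}rec t : 0 < t < eps2 -> almost_record t.
  case: rec => [rec|nrec]; [exact: rec|exfalso].
  have [||u /andP[u0 ue] ur] := @exists_almost_record (Num.min eps1 eps2).
  - by rewrite lt_min eps1_gt0.
  - move=> u /andP[u0]; rewrite lt_min => /andP[ue _].
    by apply: lne; rewrite u0 (lt_trans ue).
  - by apply: (nrec u _ ur); rewrite u0; move: ue; rewrite lt_min => /andP[].
exists (Num.min eps1 eps2), W, (\sum_i 2 * A * (k i)%:R); split.
- by rewrite lt_min eps1_gt0.
- move=> t /andP[t0]; rewrite lt_min => /andP[te _]; rewrite normrN ger0_norm; last first.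
    by apply: sumr_ge0 => i _; rewrite fine_ge0 // total_variation_ge0 // ltW.
  by apply: ler_sum => i _; rewrite -lee_fin fineK ?TVfin ?TVk // ltW.
- move=> s t s0 st; rewrite lt_min => /andP[te _].
  by rewrite -subr_ge0; apply: le_trans (XW s t s0 st (ltW te)); apply: sumr_ge0.
move=> x t bx t0 tx; rewrite lt_min => /andP[xe1 xe2].
have -> : 2 * C * Num.sqrt (S x) = C * (2 * Num.sqrt (S x)) by ring.
have K0 : 0 <= 2 * Num.sqrt (S x) by rewrite mulr_ge0 ?sqrtr_ge0.
apply: (level_slope_bound C0 K0 tx fC (x := X)).
  move=> s /andP[ts sx]; have s0 := lt_le_trans t0 ts.
  have sX : talweg s (X s) by apply: XP; rewrite s0 (le_lt_trans sx) // (lt_trans xe1).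
  split; first by case: sX.
  have -> : 2 * Num.sqrt (S x) = Num.sqrt (4 * S x).
    rewrite sqrtrM // (_ : 4 = 2 ^+ 2) ?sqrtr_sqr ?ger0_norm //; ring.
  rewrite ler_wsqrtr //; move: sx; rewrite le_eqVlt => /orP[/eqP sx|sx].
    have lx : level s x by split.
    by have := talweg_min sX lx; have := S_ge0 x; lra.
  have [|||z [lz Sz]] := rec (f x) _ s _ x.
  - by rewrite xe2 (lt_trans s0).
  - by rewrite s0.
  - by split.
  by apply: le_trans Sz; apply: talweg_min lz.
by move=> s u ts su ux; apply: XW => //; [exact: lt_le_trans ts|exact: le_trans ux (ltW _)].
Qed.

End Level.
End KurdykaLojasiewicz.

(** * Polynomial functions of Hermitian families *)

Section PolynomialFunctions.
Variables (R : realType) (d : nat) (N : 'I_d -> nat).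
Local Notation K := (freqs N).
Local Notation H := (hfam R N).
Implicit Types (J : H -> R) (h : K) (x y v : H).

Inductive polyfun : (H -> R) -> Prop :=
| polyfun_cst c : polyfun (fun=> c)
| polyfun_re h : polyfun (re_coef h)
| polyfun_im h : polyfun (im_coef h)
| polyfunD J J' : polyfun J -> polyfun J' -> polyfun (fun x => J x + J' x)
| polyfunM J J' : polyfun J -> polyfun J' -> polyfun (fun x => J x * J' x).

Lemma polyfun_sum (I : Type) (r : seq I) (P : pred I) (F : I -> H -> R) :
  (forall i, polyfun (F i)) -> polyfun (fun x => \sum_(i <- r | P i) F i x).
Proof.
move=> PF; elim: r => [|i r IHr].
  by under eq_fun do rewrite big_nil; apply: polyfun_cst.
by under eq_fun do rewrite big_cons; case: (P i) => //; apply: polyfunD.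
Qed.

Lemma polyfun_differentiable J x : polyfun J -> differentiable J x.
Proof.
move=> PJ; elim: PJ x => [c|h|h|J1 J2 _ IH1 _ IH2|J1 J2 _ IH1 _ IH2] x.
- exact: differentiable_cst.
- exact: re_coef_differentiable.
- exact: im_coef_differentiable.
- exact: differentiableD.
- exact: differentiableM.
Qed.

Lemma re_coef_diff h x v : 'd (re_coef h : H -> R) x v = re_coef h v.
Proof.
by rewrite diff_lin // => y; apply: differentiable_continuous; exact: re_coef_differentiable.
Qed.

Lemma im_coef_diff h x v : 'd (im_coef h : H -> R) x v = im_coef h v.
Proof.
by rewrite diff_lin // => y; apply: differentiable_continuous; exact: im_coef_differentiable.
Qed.

Lemma polyfun_diffD J1 J2 x v : polyfun J1 -> polyfun J2 ->
  'd (fun y => J1 y + J2 y) x v = 'd J1 x v + 'd J2 x v.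
Proof.
move=> /(polyfun_differentiable x) d1 /(polyfun_differentiable x) d2.
exact: (congr1 (fun f : H -> R => f v) (diffD d1 d2)).
Qed.

Lemma polyfun_diffM J1 J2 x v : polyfun J1 -> polyfun J2 ->
  'd (fun y => J1 y * J2 y) x v = J1 x * 'd J2 x v + J2 x * 'd J1 x v.
Proof.
move=> /(polyfun_differentiable x) d1 /(polyfun_differentiable x) d2.
exact: (congr1 (fun f : H -> R => f v) (diffM d1 d2)).
Qed.

Lemma polyfun_diff J v : polyfun J -> polyfun (fun x => 'd J x v).
Proof.
elim=> [c|h|h|J1 J2 P1 IH1 P2 IH2|J1 J2 P1 IH1 P2 IH2].
- by under eq_fun do rewrite diff_cst; apply: polyfun_cst.
- by under eq_fun do rewrite re_coef_diff; apply: polyfun_cst.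
- by under eq_fun do rewrite im_coef_diff; apply: polyfun_cst.
- by under eq_fun do rewrite polyfun_diffD //; apply: polyfunD.
- by under eq_fun do rewrite polyfun_diffM //; apply: polyfunD; apply: polyfunM.
Qed.

Lemma norm_re_coef_le h x : `|re_coef h x| <= `|x|.
Proof.
rewrite -ler_sqr ?nnegrE // real_normK ?num_real //.
by apply: le_trans (norm_coef_le h x); rewrite lerDl sqr_ge0.
Qed.

Lemma norm_im_coef_le h x : `|im_coef h x| <= `|x|.
Proof.
rewrite -ler_sqr ?nnegrE // real_normK ?num_real //.
by apply: le_trans (norm_coef_le h x); rewrite lerDr sqr_ge0.
Qed.

Lemma polyfun_bounded J r : polyfun J ->
  exists2 C, 0 <= C & forall x, `|x| <= r -> `|J x| <= C.
Proof.
elim=> [c|h|h|J1 J2 _ [C1 C10 H1] _ [C2 C20 H2]|J1 J2 _ [C1 C10 H1] _ [C2 C20 H2]].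
- by exists `|c|.
- exists `|r| => // x xr; rewrite (le_trans (norm_re_coef_le _ _)) // (le_trans xr) //.
  exact: ler_norm.
- exists `|r| => // x xr; rewrite (le_trans (norm_im_coef_le _ _)) // (le_trans xr) //.
  exact: ler_norm.
- exists (C1 + C2) => [|x xr]; first exact: addr_ge0.
  by rewrite (le_trans (ler_normD _ _)) // lerD ?H1 ?H2.
- exists (C1 * C2) => [|x xr]; first exact: mulr_ge0.
  by rewrite normrM ler_pM ?H1 ?H2.
Qed.

Lemma polyfun_lipschitz J r : polyfun J ->
  exists2 C, 0 <= C & forall x y, `|x| <= r -> `|y| <= r -> `|J y - J x| <= C * `|y - x|.
Proof.
elim=> [c|h|h|J1 J2 _ [C1 C10 H1] _ [C2 C20 H2]|J1 J2 P1 [C1 C10 H1] P2 [C2 C20 H2]].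
- by exists 0 => // x y _ _; rewrite subrr normr0 mul0r.
- by exists 1 => // x y _ _; rewrite -linearB mul1r norm_re_coef_le.
- by exists 1 => // x y _ _; rewrite -linearB mul1r norm_im_coef_le.
- exists (C1 + C2) => [|x y xr yr]; first exact: addr_ge0.
  rewrite opprD addrACA mulrDl (le_trans (ler_normD _ _)) // lerD ?H1 ?H2 //.
- have [B1 B10 J1B] := polyfun_bounded r P1; have [B2 B20 J2B] := polyfun_bounded r P2.
  exists (C1 * B2 + B1 * C2) => [|x y xr yr]; first by rewrite addr_ge0 ?mulr_ge0.
  have -> : J1 y * J2 y - J1 x * J2 x = (J1 y - J1 x) * J2 y + J1 x * (J2 y - J2 x) by ring.
  rewrite (le_trans (ler_normD _ _)) // !normrM mulrDl lerD //.
    by rewrite mulrAC ler_pM ?H1 ?J2B.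
  by rewrite -mulrA ler_pM ?H2 ?J1B.
Qed.

Lemma polyfun_remainder J r : polyfun J -> exists2 C, 0 <= C &
  forall x y, `|x| <= r -> `|y| <= r -> `|J y - J x - 'd J x (y - x)| <= C * `|y - x| ^+ 2.
Proof.
elim=> [c|h|h|J1 J2 P1 [C1 C10 H1] P2 [C2 C20 H2]|J1 J2 P1 [C1 C10 H1] P2 [C2 C20 H2]].
- by exists 0 => // x y _ _; rewrite diff_cst !subrr normr0 mul0r.
- by exists 0 => // x y _ _; rewrite re_coef_diff linearB subrr normr0 mul0r.
- by exists 0 => // x y _ _; rewrite im_coef_diff linearB subrr normr0 mul0r.
- exists (C1 + C2) => [|x y xr yr]; first exact: addr_ge0.
  rewrite polyfun_diffD // mulrDl.
  have -> (a b c d1 d2 e : R) : a + b - (c + d1) - (d2 + e) = (a - c - d2) + (b - d1 - e) by ring.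
  by rewrite (le_trans (ler_normD _ _)) // lerD ?H1 ?H2 //.
have [B1 B10 J1B] := polyfun_bounded r P1; have [B2 B20 J2B] := polyfun_bounded r P2.
have [L1 L10 J1L] := polyfun_lipschitz r P1; have [L2 L20 J2L] := polyfun_lipschitz r P2.
exists (B1 * C2 + B2 * C1 + L1 * L2) => [|x y xr yr].
  by rewrite !addr_ge0 ?mulr_ge0.
rewrite polyfun_diffM //; have := H2 x y xr yr; have := H1 x y xr yr.
move: ('d J1 x (y - x)) ('d J2 x (y - x)) => u v {}H1 {}H2.
have -> : J1 y * J2 y - J1 x * J2 x - (J1 x * v + J2 x * u) = J1 x * (J2 y - J2 x - v) +
  J2 x * (J1 y - J1 x - u) + (J1 y - J1 x) * (J2 y - J2 x) by ring.
apply: le_trans (ler_normD _ _) _; rewrite [leRHS]mulrDl; apply: lerD.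
  apply: le_trans (ler_normD _ _) _; rewrite !normrM [leRHS]mulrDl; apply: lerD.
    by rewrite -mulrA ler_pM ?J1B.
  by rewrite -mulrA ler_pM ?J2B.
by rewrite normrM expr2 mulrACA ler_pM ?J1L ?J2L.
Qed.

Definition slope2 J x : R :=
  \sum_h ('d J x (basis_re R h) ^+ 2 + 'd J x (basis_im R h) ^+ 2).

Lemma slope2_ge0 J x : 0 <= slope2 J x.
Proof. by apply: sumr_ge0 => h _; rewrite addr_ge0 ?sqr_ge0. Qed.

Lemma polyfun_slope2 J : polyfun J -> polyfun (slope2 J).
Proof.
move=> PJ; apply: polyfun_sum => h.
by apply: polyfunD; under eq_fun do rewrite expr2; apply: polyfunM; apply: polyfun_diff.
Qed.

Lemma diff_basis_le J x h : `|'d J x (basis_re R h)| <= Num.sqrt (slope2 J x) /\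
  `|'d J x (basis_im R h)| <= Num.sqrt (slope2 J x).
Proof.
rewrite -!sqrtr_sqr; split; apply: ler_wsqrtr; rewrite /slope2 (bigD1 h) //=.
  rewrite -addrA lerDl addr_ge0 ?sqr_ge0 // sumr_ge0 // => k _.
  by rewrite addr_ge0 ?sqr_ge0.
rewrite -addrA addrCA lerDl addr_ge0 ?sqr_ge0 // sumr_ge0 // => k _.
by rewrite addr_ge0 ?sqr_ge0.
Qed.

End PolynomialFunctions.

(** * Real coordinates *)

Section Coordinates.
Variables (R : realType) (d : nat) (N : 'I_d -> nat).
Local Notation K := (freqs N).
Local Notation H := (hfam R N).
Implicit Types (J : H -> R) (h : K) (x y : H).

Local Notation dim := (#|{: K}| + #|{: K}|)%N.
Local Notation re_ind h := (lshift #|{: K}| (enum_rank h)).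
Local Notation im_ind h := (rshift #|{: K}| (enum_rank h)).
Implicit Types (v w : 'rV[R]_dim).

Definition of_coords v : H :=
  \sum_h (v 0 (re_ind h) *: basis_re R h + v 0 (im_ind h) *: basis_im R h).

Definition coords x : 'rV[R]_dim := row_mx
  (\row_i re_coef (enum_val i) x) (\row_i im_coef (enum_val i) x).

Lemma coordsK : cancel coords of_coords.
Proof.
move=> x; rewrite [RHS]hfam_basis; apply: eq_bigr => h _.
by rewrite row_mxEl row_mxEr !mxE enum_rankK.
Qed.

Lemma of_coordsB v w : of_coords (v - w) = of_coords v - of_coords w.
Proof.
rewrite /of_coords -sumrB; apply: eq_bigr => h _.
by rewrite !mxE opprD addrACA -!scalerBl.
Qed.

Lemma linear_of_coords (f : {linear H -> R}) v : f (of_coords v) =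
  \sum_h (v 0 (re_ind h) * f (basis_re R h) + v 0 (im_ind h) * f (basis_im R h)).
Proof.
by rewrite linear_sum; apply: eq_bigr => h _; rewrite linearD !linearZ.
Qed.

Lemma norm1_coords v : norm1 v = \sum_h (`|v 0 (re_ind h)| + `|v 0 (im_ind h)|).
Proof.
rewrite /norm1 big_split_ord big_split; congr (_ + _).
  by rewrite (reindex (@enum_rank K)) //; apply: onW_bij; exact: enum_rank_bij.
by rewrite (reindex (@enum_rank K)) //; apply: onW_bij; exact: enum_rank_bij.
Qed.

Lemma linear_of_coords_le (f : {linear H -> R}) M v :
  (forall h, `|f (basis_re R h)| <= M /\ `|f (basis_im R h)| <= M) ->
  `|f (of_coords v)| <= M * norm1 v.
Proof.
move=> fM; rewrite linear_of_coords norm1_coords mulr_sumr.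
apply: le_trans (ler_norm_sum _ _ _) _; apply: ler_sum => h _.
have [reM imM] := fM h.
rewrite (le_trans (ler_normD _ _)) // !normrM [_ * `|f _|]mulrC [X in _ + X]mulrC.
by rewrite mulrDr lerD // ler_wpM2r.
Qed.

Lemma norm_of_coords_le : exists2 M, 0 <= M & forall v, `|of_coords v| <= M * norm1 v.
Proof.
exists (\sum_(h : K) (`|basis_re R h| + `|basis_im R h|)) => [|v].
  by apply: sumr_ge0 => h _; rewrite addr_ge0.
rewrite norm1_coords mulr_sumr /of_coords.
apply: le_trans (ler_norm_sum _ _ _) _; apply: ler_sum => h _.
rewrite (le_trans (ler_normD _ _)) // !normrZ mulrDr.
have sum0 k : 0 <= \sum_(j | j != k) (`|basis_re R j| + `|basis_im R j|).
  by rewrite sumr_ge0 // => j _; rewrite addr_ge0.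
apply: lerD; rewrite mulrC ler_wpM2r // (bigD1 h) //=.
  by rewrite -addrA lerDl addr_ge0 // sum0.
by rewrite -addrA addrCA lerDl addr_ge0 // sum0.
Qed.

Lemma term_fun_sum (I : Type) (r : seq I) (F : I -> seq R -> R) :
  (forall i, term_fun (F i)) -> term_fun (fun e => \sum_(i <- r) F i e).
Proof.
move=> tF; elim: r => [|i r IHr].
  by under eq_fun do rewrite big_nil; apply: term_fun_cst.
by under eq_fun do rewrite big_cons; apply: term_funD.
Qed.

Lemma polyfun_term J : polyfun J -> term_block_fun (fun v => J (of_coords v)).
Proof.
have coord (f : {linear H -> R}) : term_block_fun (fun v => f (of_coords v)).
  move=> o; under eq_fun do rewrite linear_of_coords.
  apply: term_fun_sum => h; apply: term_funD; apply: term_funM.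
  - exact: term_block_coord.
  - exact: term_fun_cst.
  - exact: term_block_coord.
  - exact: term_fun_cst.
elim=> [c|h|h|J1 J2 _ IH1 _ IH2|J1 J2 _ IH1 _ IH2].
- by move=> o; apply: term_fun_cst.
- exact: coord.
- exact: coord.
- by move=> o; apply: term_funD.
- by move=> o; apply: term_funM.
Qed.

Lemma continuous_sumr (T : topologicalType) (I : Type) (r : seq I) (F : I -> T -> R) :
  (forall i, continuous (F i)) -> continuous (fun p => \sum_(i <- r) F i p).
Proof.
move=> cF; elim: r => [|i r IHr].
  by under eq_fun do rewrite big_nil; move=> x; apply: cst_continuous.
under eq_fun do rewrite big_cons.
by move=> x; exact: (continuousD (cF i x) (IHr x)).
Qed.

Lemma polyfun_of_coords_continuous J : polyfun J ->
  continuous (fun v => J (of_coords v)).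
Proof.
have coord (f : {linear H -> R}) : continuous (fun v => f (of_coords v)).
  under eq_fun do rewrite linear_of_coords.
  apply: continuous_sumr => h v.
  have vE i : {for v, continuous (fun v : 'rV[R]_dim => v 0 i)} by exact: coord_continuous.
  have cE (k : R) : {for v, continuous (fun=> k : R)} by exact: cst_continuous.
  exact: (continuousD (continuousM (vE _) (cE _)) (continuousM (vE _) (cE _))).
elim=> [c|h|h|J1 J2 _ IH1 _ IH2|J1 J2 _ IH1 _ IH2].
- by move=> v; apply: cst_continuous.
- exact: coord.
- exact: coord.
- by move=> v; exact: (continuousD (IH1 v) (IH2 v)).
- by move=> v; exact: (continuousM (IH1 v) (IH2 v)).
Qed.

Lemma polyfun_lojasiewicz J l r : polyfun J -> 0 <= r ->
  exists eps (W : R -> R) L C, [/\ 0 < eps, 0 <= C,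
    forall t, 0 < t < eps -> `|W t| <= L,
    forall s t, 0 < s -> s <= t -> t < eps -> W s <= W t &
    forall x t, `|x| <= r -> 0 < t -> t <= J x - l -> J x - l < eps ->
      J x - l - t <= C * Num.sqrt (slope2 J x) * (W (J x - l) - W t)].
Proof.
move=> PJ r0; have PS := polyfun_slope2 PJ.
have Pl := polyfunD PJ (polyfun_cst N (- l)).
have [M M0 HM] := norm_of_coords_le.
pose r' := M * (dim%:R * r).
have boxr' v : box r v -> `|of_coords v| <= r'.
  move=> bv; rewrite (le_trans (HM v)) // ler_wpM2l // /norm1.
  rewrite (le_trans (ler_sum _ (fun i _ => bv i))) // sumr_const card_ord.
  by rewrite mulr_natl.
have [C C0 HC] := polyfun_remainder r' PJ.
have C'0 : 0 < 1 + C * M ^+ 2 by rewrite ltr_pwDl // mulr_ge0 ?sqr_ge0.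
have [|eps [W [L [e0 WL Wmono KL]]]] := @kurdyka_lojasiewicz _ _
  (fun v => J (of_coords v) - l) (fun v => slope2 J (of_coords v)) r
  (polyfun_term Pl) (polyfun_term PS) (polyfun_of_coords_continuous Pl)
  (polyfun_of_coords_continuous PS) (fun v => slope2_ge0 J _) r0 _ C'0.
- move=> v w /boxr' vr /boxr' wr; rewrite opprB addrA subrK.
  have := HC _ _ vr wr; rewrite -of_coordsB ler_norml => /andP[_ rem].
  have := @linear_of_coords_le ('d J (of_coords v)) _ (w - v) (diff_basis_le J (of_coords v)).
  rewrite ler_norml => /andP[_ lin].
  have sq : C * `|of_coords (w - v)| ^+ 2 <= C * M ^+ 2 * norm1 (w - v) ^+ 2.
    rewrite -mulrA ler_wpM2l // -exprMn ler_sqr ?nnegrE ?HM //.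
    by rewrite mulr_ge0 // /norm1 sumr_ge0.
  have n0 : 0 <= Num.sqrt (slope2 J (of_coords v)) * norm1 (w - v).
    by rewrite mulr_ge0 ?sqrtr_ge0 // /norm1 sumr_ge0.
  have C1 : 0 <= C * M ^+ 2 by rewrite mulr_ge0 ?sqr_ge0.
  have := mulr_ge0 C1 n0; have := sqr_ge0 (norm1 (w - v)).
  by rewrite mulrDl mul1r mulrDr; lra.
exists eps, W, L, (2 * (1 + C * M ^+ 2)); split => //.
  by rewrite mulr_ge0 // ltW.
move=> x t xr t0 tx xe; have := KL (coords x) t; rewrite coordsK; apply => //.
move=> i; rewrite -(splitK i); case: (fintype.split i) => j.
  by rewrite row_mxEl mxE (le_trans (norm_re_coef_le _ _)).
by rewrite row_mxEr mxE (le_trans (norm_im_coef_le _ _)).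
Qed.

End Coordinates.

(** * The energy and the proximal step *)

Section EnergyPolynomial.
Variables (R : realType) (d : nat) (N : 'I_d -> nat).
Variables (B : 'M[R]_d) (xi tau gamma : R).
Local Notation K := (freqs N).
Local Notation H := (hfam R N).
Local Notation F := (@energyF R d N tau gamma).
Local Notation G := (@energyG R d N B xi).
Local Notation E := (@energy R d N B xi tau gamma).

Definition cpolyfun (f : H -> R[i]) : Prop :=
  polyfun (fun x => complex.Re (f x)) /\ polyfun (fun x => complex.Im (f x)).

Lemma cpolyfun_cst z : cpolyfun (fun=> z).
Proof. by split; apply: polyfun_cst. Qed.

Lemma cpolyfun_coef h : cpolyfun (fun x => x h).
Proof. by split; [apply: polyfun_re|apply: polyfun_im]. Qed.

Lemma cpolyfunD f g : cpolyfun f -> cpolyfun g -> cpolyfun (fun x => f x + g x).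
Proof.
move=> [rf jf] [rg jg]; split.
  rewrite (_ : (fun _ => _) = (fun x => complex.Re (f x) + complex.Re (g x))).
    exact: polyfunD.
  by apply/funext => x; case: (f x) (g x) => [? ?] [? ?].
rewrite (_ : (fun _ => _) = (fun x => complex.Im (f x) + complex.Im (g x))).
  exact: polyfunD.
by apply/funext => x; case: (f x) (g x) => [? ?] [? ?].
Qed.

Lemma cpolyfunM f g : cpolyfun f -> cpolyfun g -> cpolyfun (fun x => f x * g x).
Proof.
move=> [rf jf] [rg jg]; split.
  rewrite (_ : (fun _ => _) = (fun x => complex.Re (f x) * complex.Re (g x) +
    -1 * (complex.Im (f x) * complex.Im (g x)))).
    apply: polyfunD; first exact: polyfunM.
    by apply: (@polyfunM _ _ _ (fun=> -1)); [exact: polyfun_cst|exact: polyfunM].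
  by apply/funext => x; case: (f x) (g x) => [? ?] [? ?] /=; rewrite mulN1r.
rewrite (_ : (fun _ => _) = (fun x => complex.Re (f x) * complex.Im (g x) +
  complex.Im (f x) * complex.Re (g x))).
  by apply: polyfunD; apply: polyfunM.
by apply/funext => x; case: (f x) (g x) => [? ?] [? ?].
Qed.

Lemma cpolyfun_sum (I : Type) (r : seq I) (P : pred I) (f : I -> H -> R[i]) :
  (forall i, cpolyfun (f i)) -> cpolyfun (fun x => \sum_(i <- r | P i) f i x).
Proof.
move=> cf; elim: r => [|i r IHr].
  by under eq_fun do rewrite big_nil; apply: cpolyfun_cst.
by under eq_fun do rewrite big_cons; case: (P i) => //; apply: cpolyfunD.
Qed.

Lemma cpolyfun_prod (I : Type) (r : seq I) (P : pred I) (f : I -> H -> R[i]) :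
  (forall i, cpolyfun (f i)) -> cpolyfun (fun x => \prod_(i <- r | P i) f i x).
Proof.
move=> cf; elim: r => [|i r IHr].
  by under eq_fun do rewrite big_nil; apply: cpolyfun_cst.
by under eq_fun do rewrite big_cons; case: (P i) => //; apply: cpolyfunM.
Qed.

Lemma polyfunZ (c : R) (J : H -> R) : polyfun J -> polyfun (fun x => c * J x).
Proof. by apply: polyfunM; apply: polyfun_cst. Qed.

Lemma energyG_polyfun : polyfun G.
Proof.
apply: polyfunZ; apply: (cpolyfun_sum _ _ _).1 => h.
apply: cpolyfunM; last exact: cpolyfun_coef.
by apply: cpolyfunM; [exact: cpolyfun_cst|exact: cpolyfun_coef].
Qed.

Lemma conv_polyfun n c : polyfun (fun x : H => c * complex.Re (Defs.conv n x)).
Proof.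
apply: polyfunZ; apply: (cpolyfun_sum _ _ _).1 => h.
by apply: cpolyfun_prod => i; apply: cpolyfun_coef.
Qed.

Lemma energyF_polyfun : polyfun F.
Proof.
apply: (@polyfunD _ _ _ (fun x : H => tau / (2`!)%:R * complex.Re (Defs.conv 2 x)
    - gamma / (3`!)%:R * complex.Re (Defs.conv 3 x))); last exact: conv_polyfun.
apply: (@polyfunD _ _ _ (fun x : H => tau / (2`!)%:R * complex.Re (Defs.conv 2 x))).
  exact: conv_polyfun.
by under eq_fun do rewrite -mulNr; apply: conv_polyfun.
Qed.

Lemma energy_polyfun : polyfun E.
Proof. by apply: polyfunD; [exact: energyF_polyfun|exact: energyG_polyfun]. Qed.

Lemma sqr_norm_hfam (x : H) : `|x| ^+ 2 = dot x x.
Proof. by rewrite norm_hfamE sqr_sqrtr // dot_ge0. Qed.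

Lemma dot0l (x : H) : dot 0 x = 0.
Proof. by have := dotDl 1 0 0 x; rewrite scale1r addr0; lra. Qed.

Lemma dotZl (a : R) (x y : H) : dot (a *: x) y = a * dot x y.
Proof. by rewrite -[a *: x]addr0 dotDl dot0l addr0. Qed.

Lemma dotDl1 (x y z : H) : dot (x + y) z = dot x z + dot y z.
Proof. by rewrite -[x]scale1r dotDl mul1r scale1r. Qed.

Lemma dotNl (x y : H) : dot (- x) y = - dot x y.
Proof. by rewrite -scaleN1r dotZl mulN1r. Qed.

Lemma dot_le (x y : H) : `|dot x y| <= `|x| * `|y|.
Proof.
rewrite -ler_sqr ?nnegrE ?mulr_ge0 // real_normK ?num_real // exprMn.
by rewrite !sqr_norm_hfam cauchy_schwarz.
Qed.

Lemma sqr_norm_hfamD (x y : H) (s : R) :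
  `|x + s *: y| ^+ 2 = `|x| ^+ 2 + 2 * s * dot x y + s ^+ 2 * `|y| ^+ 2.
Proof.
rewrite !sqr_norm_hfam dotDl1 dotZl !(dotC _ (_ + _)) !dotDl1 !dotZl (dotC y x).
ring.
Qed.

Lemma first_order_zero (a b : R) : 0 <= b ->
  (forall s, `|s| <= 1 -> 0 <= s * a + s ^+ 2 * b) -> a = 0.
Proof.
move=> b0 H; pose t := (1 + b + `|a|)^-1.
have D0 : 0 < 1 + b + `|a| by have := normr_ge0 a; lra.
have t0 : 0 < t by rewrite invr_gt0.
have tD : t * (1 + b + `|a|) = 1 by rewrite mulVf // gt_eqF.
have /H : `|- (a * t)| <= 1.
  rewrite normrN normrM (gtr0_norm t0) -tD mulrC ler_pM2l //; lra.
have tb : t * b < 1 by rewrite -tD ltr_pM2l //; have := normr_ge0 a; lra.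
have -> : - (a * t) * a + (- (a * t)) ^+ 2 * b = - (a ^+ 2 * (t * (1 - t * b))) by ring.
rewrite oppr_ge0 => le0; apply/eqP; rewrite -sqrf_eq0 eq_le sqr_ge0 andbT.
by rewrite -(pmulr_lle0 _ (_ : 0 < t * (1 - t * b))) // mulr_gt0 // subr_gt0.
Qed.

Lemma prox_diff (a : R) (z v : H) : 0 < a ->
  'd G (prox G a z) v = a^-1 * dot (z - prox G a z) v.
Proof.
move=> a0; set y := prox G a z.
have /(proxP B xi z _ a0) y_min : y = prox G a z by [].
have [C C0 HC] := polyfun_remainder (`|y| + `|v|) energyG_polyfun.
pose c := (2 * a)^-1; have c0 : 0 < c by rewrite invr_gt0 mulr_gt0.
apply/eqP; rewrite -subr_eq0; apply/eqP.
apply: (@first_order_zero _ ((C + c) * `|v| ^+ 2)).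
  by rewrite mulr_ge0 ?sqr_ge0 // addr_ge0 // ltW.
move=> s s1; have := y_min (y + s *: v); rewrite /prox_obj -/c.
have -> : y + s *: v - z = (y - z) + s *: v by rewrite addrAC.
rewrite sqr_norm_hfamD.
have yr : `|y| <= `|y| + `|v| by rewrite lerDl.
have yvr : `|y + s *: v| <= `|y| + `|v|.
  rewrite (le_trans (ler_normD _ _)) // lerD2l normrZ -[leRHS]mul1r.
  by rewrite ler_wpM2r.
have := HC _ _ yr yvr; have -> : y + s *: v - y = s *: v by rewrite addrC addKr.
have -> : 'd G y (s *: v) = s * 'd G y v by apply: linearZ.
rewrite ler_norml => /andP[_].
rewrite normrZ exprMn real_normK ?num_real //.
have -> : dot (z - y) v = - dot (y - z) v by rewrite -dotNl opprB.
have -> : a^-1 = 2 * c by rewrite /c invfM mulrA divff ?mul1r // pnatr_eq0.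
by move=> h1 h2; lra.
Qed.

Lemma prox_step_slope (r a : R) : 0 < a -> exists2 C, 0 <= C &
  forall (y : H) alpha, a <= alpha -> `|y| <= r -> `|prox_step F G y alpha| <= r ->
    Num.sqrt (slope2 E (prox_step F G y alpha)) <= C * `|y - prox_step F G y alpha|.
Proof.
move=> a0.
have bound (b : H) : exists2 C, 0 <= C & forall y alpha, a <= alpha -> `|y| <= r ->
    `|prox_step F G y alpha| <= r ->
    'd E (prox_step F G y alpha) b ^+ 2 <= (C * `|y - prox_step F G y alpha|) ^+ 2.
  have [C C0 HC] := polyfun_lipschitz r (polyfun_diff b energyF_polyfun).
  exists (C + a^-1 * `|b|) => [|y alpha aalpha yr pr].
    by rewrite addr_ge0 // mulr_ge0 // invr_ge0 ltW.
  have alpha0 : 0 < alpha := lt_le_trans a0 aalpha.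
  rewrite -ler_sqrt ?sqr_ge0 // !sqrtr_sqr [leRHS]ger0_norm; last first.
    by rewrite mulr_ge0 // addr_ge0 // mulr_ge0 // invr_ge0 ltW.
  rewrite polyfun_diffD; [|exact: energyF_polyfun|exact: energyG_polyfun].
  rewrite prox_diff // -/(prox_step F G y alpha); set p := prox_step F G y alpha in pr *.
  have [_ gE] := gradientP (energyF_differentiable tau gamma y).
  have -> : dot (y - alpha *: gradient F y - p) b = dot (y - p) b - alpha * 'd F y b.
    by rewrite addrAC dotDl1 dotNl dotZl gE.
  rewrite mulrBr mulKf ?gt_eqF //.
  have h1 := HC _ _ pr yr.
  have h2 : `|alpha^-1 * dot (y - p) b| <= a^-1 * `|b| * `|y - p|.
    rewrite normrM gtr0_norm ?invr_gt0 // -mulrA ler_pM ?invr_ge0 ?(ltW alpha0) //.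
      by rewrite lef_pV2 ?posrE.
    by rewrite mulrC dot_le.
  have -> (X Y Z : R) : X + (Y - Z) = Y - (Z - X) by ring.
  by rewrite (le_trans (ler_normB _ _)) // mulrDl addrC lerD.
have /choice[Cre reP] : forall h : K, exists C, 0 <= C /\ forall y alpha, a <= alpha ->
    `|y| <= r -> `|prox_step F G y alpha| <= r ->
    'd E (prox_step F G y alpha) (basis_re R h) ^+ 2 <= (C * `|y - prox_step F G y alpha|) ^+ 2.
  by move=> h; have [C ? ?] := bound (basis_re R h); exists C.
have /choice[Cim imP] : forall h : K, exists C, 0 <= C /\ forall y alpha, a <= alpha ->
    `|y| <= r -> `|prox_step F G y alpha| <= r ->
    'd E (prox_step F G y alpha) (basis_im R h) ^+ 2 <= (C * `|y - prox_step F G y alpha|) ^+ 2.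
  by move=> h; have [C ? ?] := bound (basis_im R h); exists C.
have S0 : 0 <= \sum_h (Cre h ^+ 2 + Cim h ^+ 2).
  by rewrite sumr_ge0 // => h _; rewrite addr_ge0 ?sqr_ge0.
exists (Num.sqrt (\sum_h (Cre h ^+ 2 + Cim h ^+ 2))); first exact: sqrtr_ge0.
move=> y alpha aalpha yr pr.
rewrite -[X in _ * X]ger0_norm // -sqrtr_sqr -sqrtrM // ler_wsqrtr //.
rewrite mulr_suml; apply: ler_sum => h _; rewrite mulrDl -!exprMn.
by apply: lerD; [apply: (reP h).2|apply: (imP h).2].
Qed.

End EnergyPolynomial.

(** * Convergence *)

Section RealSequences.
Variable R : realType.

Lemma steps_bounded (d om : nat -> R) (D L : R) : 0 <= D ->
  (forall n, 0 <= d n) -> (forall n, `|om n| <= L) -> (forall n, om n.+1 <= om n) ->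
  (forall n, d n.+2 ^+ 2 <= (d n.+1 + d n) * (D * (om n - om n.+1))) ->
  exists C, forall n, \sum_(i < n) d i <= C.
Proof.
move=> D0 d0 omL om_le dle.
have amgm n : d n.+2 <= (d n.+1 + d n) / 4 + D * (om n - om n.+1).
  have := dle n; have := d0 n; have := d0 n.+1; have := d0 n.+2.
  have : 0 <= D * (om n - om n.+1) by rewrite mulr_ge0 // subr_ge0.
  move: (d n.+2) (d n.+1) (d n) (D * _) => a b c z z0 a0 b0 c0 le.
  rewrite -ler_sqr ?nnegrE //; last by lra.
  by have := sqr_ge0 ((b + c) / 4 - z); nra.
pose s n := \sum_(i < n) d i.
have sS n : s n.+1 = s n + d n by rewrite /s big_ord_recr.
have s_le n : s n <= s n.+1 by rewrite sS lerDl.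
have main n : s n.+2 <= d 0%N + d 1%N + s n.+1 / 4 + s n / 4 + D * (om 0%N - om n).
  elim: n => [|n IHn].
    have s0 : s 0%N = 0 by rewrite /s big_ord0.
    by rewrite !sS s0; have := d0 0%N; lra.
  by have := amgm n; rewrite (sS n.+2); have := sS n.+1; have := sS n; lra.
exists (2 * (d 0%N + d 1%N + D * (2 * L))) => n.
have D2L : D * (om 0%N - om n) <= D * (2 * L).
  rewrite ler_wpM2l //; have := omL 0%N; have := omL n.
  by rewrite !ler_norml => /andP[? ?] /andP[? ?]; lra.
change (s n <= 2 * (d 0%N + d 1%N + D * (2 * L))).
by have := main n; have := s_le n; have := s_le n.+1; lra.
Qed.

Lemma cvgn_of_steps_bounded (u d : nat -> R) C :
  (forall n, `|u n.+1 - u n| <= d n) -> (forall n, \sum_(i < n) d i <= C) -> cvgn u.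
Proof.
move=> ud dC; pose s n := \sum_(i < n) d i.
have sS n : s n.+1 = s n + d n by rewrite /s big_ord_recr.
have d0 n : 0 <= d n by apply: le_trans (ud n).
have s_cvg : cvgn s.
  apply: nondecreasing_is_cvgn; last by exists C => _ [n _ <-]; exact: dC.
  by apply/nondecreasing_seqP => n; rewrite sS lerDl d0.
have ub n : `|u n| <= `|u 0%N| + s n.
  elim: n => [|n IHn]; first by rewrite /s big_ord0 addr0.
  have -> : u n.+1 = u n + (u n.+1 - u n) by rewrite addrC subrK.
  by rewrite sS [leRHS]addrA (le_trans (ler_normD _ _)) // lerD.
have us_cvg : cvgn (u + s).
  apply: nondecreasing_is_cvgn.
    apply/nondecreasing_seqP => n; rewrite !fctE sS.
    by have := ud n; rewrite ler_norml => /andP[? ?]; lra.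
  exists (`|u 0%N| + C + C) => _ [n _ <-]; rewrite fctE.
  by have := ub n; have := dC n; have := ler_norm (u n); rewrite /s; lra.
have -> : u = (u + s) - s by apply/funext => n; rewrite !fctE addrK.
exact: is_cvgB.
Qed.

Lemma limn_einf_gt0 (u : nat -> R) : (0 < limn_einf (fun k => (u k)%:E))%E ->
  exists2 a, 0 < a & exists n0, forall n, (n0 <= n)%N -> a <= u n.
Proof.
set v := fun k => _; rewrite limn_einf_lim (cvg_lim _ (@cvg_einfs_sup _ v)) //.
move=> /ereal_sup_gt[_ [n0 _ <-] inf_gt0].
have inf_le n : (n0 <= n)%N -> (einfs v n0 <= (u n)%:E)%E.
  by move=> n0n; apply: ereal_inf_lbound; exists n.
case: (einfs v n0) inf_gt0 inf_le => [r| |] //.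
  by rewrite lte_fin => r0 inf_le; exists r => //; exists n0 => n /inf_le; rewrite lee_fin.
by move=> _ inf_le; exists 1 => //; exists n0 => n /inf_le; rewrite leye_eq.
Qed.

End RealSequences.

Section Convergence.
Variables (R : realType) (d : nat) (N : 'I_d -> nat).
Local Notation K := (freqs N).
Local Notation H := (hfam R N).

Lemma cvg_sumr (I : Type) (r : seq I) (x : I -> nat -> H) (l : I -> H) :
  (forall i, x i @ \oo --> l i) ->
  (fun n => \sum_(i <- r) x i n) @ \oo --> \sum_(i <- r) l i.
Proof.
move=> xl; elim: r => [|i r IHr].
  by under eq_fun do rewrite big_nil; rewrite big_nil; apply: cvg_cst.
under eq_fun do rewrite big_cons; rewrite big_cons.
exact: (cvgD (xl i) IHr).
Qed.

Lemma hfam_cvg (x : nat -> H) (s : nat -> R) C :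
  (forall n, `|x n.+1 - x n| <= s n) -> (forall n, \sum_(i < n) s i <= C) ->
  exists l : H, x @ \oo --> l.
Proof.
move=> xs sC.
have re_cvg (h : K) : cvgn (fun n => re_coef h (x n)).
  apply: (cvgn_of_steps_bounded _ sC) => n; rewrite -linearB.
  exact: le_trans (norm_re_coef_le _ _) (xs n).
have im_cvg (h : K) : cvgn (fun n => im_coef h (x n)).
  apply: (cvgn_of_steps_bounded _ sC) => n; rewrite -linearB.
  exact: le_trans (norm_im_coef_le _ _) (xs n).
exists (\sum_(h : K) (limn (fun n => re_coef h (x n)) *: basis_re R h +
                      limn (fun n => im_coef h (x n)) *: basis_im R h)).
have xE : x = fun n => \sum_(h : K) (re_coef h (x n) *: basis_re R h +
                                     im_coef h (x n) *: basis_im R h).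
  by apply/funext => n; rewrite -hfam_basis.
rewrite [X in X @ \oo --> _]xE.
apply: cvg_sumr => h; apply: cvgD; apply: cvgZr_tmp.
  exact: re_cvg h.
exact: im_cvg h.
Qed.

Lemma slope2_eq0 (J : H -> R) x : slope2 J x = 0 -> forall v, 'd J x v = 0.
Proof.
move=> S0 v; rewrite -(coordsK v); apply/eqP; rewrite -normr_le0.
have := @linear_of_coords_le _ _ _ ('d J x) _ (coords v) (diff_basis_le J x).
by rewrite S0 sqrtr0 mul0r.
Qed.

Section Descent.
Variables (J : H -> R) (x : nat -> H) (r delta C : R).
Hypotheses (PJ : polyfun J) (x_r : forall n, `|x n| <= r).
Hypotheses (delta_gt0 : 0 < delta) (C_ge0 : 0 <= C) (J_lb : has_lbound (range J)).
Hypothesis descent : forall n, delta * `|x n - x n.+1| ^+ 2 <= J (x n) - J (x n.+1).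
Hypothesis slope : forall n,
  Num.sqrt (slope2 J (x n.+2)) <= C * (`|x n.+1 - x n.+2| + `|x n - x n.+1|).

Lemma descent_steps_bounded : exists C' n0, forall n,
  \sum_(i < n) `|x (n0 + i)%N - x (n0 + i).+1| <= C'.
Proof.
have J_le n : J (x n.+1) <= J (x n).
  by rewrite -subr_ge0; apply: le_trans (descent n); rewrite mulr_ge0 ?sqr_ge0 // ltW.
have J_anti : nonincreasing_seq (J \o x) by apply/nonincreasing_seqP.
have J_cvg : cvgn (J \o x).
  apply: nonincreasing_is_cvgn => //; have [m mJ] := J_lb.
  by exists m => _ [n _ <-]; apply: mJ; exists (x n).
set l := limn (J \o x) in J_cvg *.
have l_le n : l <= J (x n) by apply: (nonincreasing_cvgn_ge J_anti).
have [[n0 Jn0]|Jne] := pselect (exists n, J (x n) = l).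
  exists 0, n0 => n; rewrite big1 // => i _; apply/eqP.
  rewrite normr_eq0 -normr_eq0 -sqrf_eq0 eq_le sqr_ge0 andbT.
  have Jl k : (n0 <= k)%N -> J (x k) = l.
    by move=> n0k; apply/eqP; rewrite eq_le l_le andbT -Jn0; exact: J_anti.
  rewrite -(pmulr_rle0 _ delta_gt0); apply: le_trans (descent _) _.
  by rewrite !Jl ?subrr // ?leqW // leq_addr.
have J_gt n : l < J (x n).
  by rewrite lt_neqAle l_le andbT; apply/eqP => Jl; apply: Jne; exists n.
have r0 : 0 <= r by apply: le_trans (x_r 0%N).
have [eps [W [L [C1 [eps0 C10 WL Wmono KL]]]]] := polyfun_lojasiewicz l PJ r0.
have [n0 _ n0P] : \forall n \near \oo, (J \o x) n < l + eps.
  by apply: (cvgr_lt l) => //; rewrite ltrDl.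
pose t n := J (x (n0 + n)%N) - l.
have t_gt0 n : 0 < t n by rewrite subr_gt0.
have t_lt n : t n < eps by rewrite /t ltrBlDl; apply: n0P; rewrite /= leq_addr.
have t_le n : t n.+1 <= t n by rewrite lerD2r addnS.
pose dd n := `|x (n0 + n)%N - x (n0 + n).+1|.
have [|||||C' C'P] := @steps_bounded R dd (fun n => W (t n.+2)) (delta^-1 * (C1 * C)) L.
- by rewrite mulr_ge0 ?invr_ge0 ?mulr_ge0 // ltW.
- by move=> n; rewrite /dd.
- by move=> n; apply: WL; rewrite t_gt0 t_lt.
- by move=> n; apply: Wmono; rewrite ?t_gt0 ?t_le ?t_lt.
- move=> n; have W_ge0 : 0 <= W (t n.+2) - W (t n.+3) by rewrite subr_ge0 Wmono.
  have := KL (x (n0 + n.+2)%N) (t n.+3) (x_r _) (t_gt0 _) (t_le _) (t_lt _).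
  rewrite -/(t n.+2) => KLn.
  have := descent (n0 + n.+2); rewrite -/(dd n.+2) => dn.
  have sn : Num.sqrt (slope2 J (x (n0 + n.+2)%N)) <= C * (dd n.+1 + dd n).
    by have := slope (n0 + n); rewrite /dd !addnS.
  rewrite -(ler_pM2l delta_gt0); apply: le_trans dn _.
  have -> : J (x (n0 + n.+2)) - J (x (n0 + n.+2).+1) = t n.+2 - t n.+3.
    by rewrite /t !addnS; ring.
  apply: le_trans KLn _.
  have -> : delta * ((dd n.+1 + dd n) * (delta^-1 * (C1 * C) * (W (t n.+2) - W (t n.+3)))) =
    C1 * (C * (dd n.+1 + dd n)) * (W (t n.+2) - W (t n.+3)).
    by have := lt0r_neq0 delta_gt0 => ?; field.
  by rewrite ler_wpM2r // ler_wpM2l // sn.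
by exists C', n0.
Qed.

Theorem descent_converges : exists l : H, is_gradient J l 0 /\ x @ \oo --> l.
Proof.
have [C' [n0 steps]] := descent_steps_bounded.
have [|l xl] := @hfam_cvg (fun n => x (n0 + n)%N)
    (fun n => `|x (n0 + n)%N - x (n0 + n).+1|) _ _ steps.
  by move=> n; rewrite addnS distrC.
have {}xl : x @ \oo --> l.
  by rewrite -(cvg_shiftn n0); move: xl; under eq_fun do rewrite addnC.
exists l; split => //; split; first exact: polyfun_differentiable.
move=> v; rewrite dot0l; apply: slope2_eq0.
have PS := polyfun_slope2 PJ.
have slx : (slope2 J \o x) @ \oo --> slope2 J l.
  apply: (cvg_comp _ _ xl).
  exact: (differentiable_continuous (polyfun_differentiable l PS)).
have sl : (Num.sqrt \o (slope2 J \o x)) @ \oo --> Num.sqrt (slope2 J l).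
  by apply: (cvg_comp _ _ slx); exact: sqrt_continuous.
have shift k : (fun n => x (n + k)%N) @ \oo --> l by rewrite cvg_shiftn.
have dist0 k m : (fun n => `|x (n + k)%N - x (n + m)%N|) @ \oo --> (0 : R).
  by rewrite -(normr0 H) -(subrr l); apply: cvg_norm; apply: cvgB; exact: shift.
have sl2 : (fun n => Num.sqrt (slope2 J (x (n + 2)%N))) @ \oo --> Num.sqrt (slope2 J l).
  by rewrite (cvg_shiftn 2 (Num.sqrt \o slope2 J \o x)).
have rhs : (fun n => C * (`|x (n + 1)%N - x (n + 2)%N| + `|x (n + 0)%N - x (n + 1)%N|))
    @ \oo --> C * (0 + 0).
  exact: (cvgM (cvg_cst C) (cvgD (dist0 1 2) (dist0 0 1)))%N.
have : Num.sqrt (slope2 J l) <= C * (0 + 0).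
  apply: (ler_cvg_to sl2 rhs); apply: nearW => n.
  by rewrite addn0 addn1 addn2; exact: slope.
rewrite addr0 mulr0 => sq0; apply/eqP; rewrite eq_le slope2_ge0 andbT.
by rewrite -sqrtr_eq0; apply/eqP/le_anti; rewrite sq0 sqrtr_ge0.
Qed.

End Descent.

Section AlgorithmStep.
Variables (F G : H -> R) (rho eta delta : R) (Nmax : nat).

Lemma apg_step_descent k (x xprev : H) kada w alpha kada' x' :
  apg_step F G rho eta delta Nmax k x xprev kada w alpha kada' x' -> delta <= eta ->
  delta * `|x - x'| ^+ 2 <= (F x + G x) - (F x' + G x').
Proof.
case=> {w alpha kada' x'} [w alpha y _ _ []//|w alpha0 alpha y _ _ _ [b [m [_ _ ok _]]] de].
by apply: le_trans ok; rewrite ler_wpM2r ?sqr_ge0.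
Qed.

Lemma apg_step_prox k (x xprev : H) kada w alpha kada' x' :
  apg_step F G rho eta delta Nmax k x xprev kada w alpha kada' x' ->
  exists2 w', 0 <= w' <= 1 & x' = prox_step F G (extrapolate w' x xprev) alpha.
Proof.
case=> {w alpha kada' x'} [w alpha y w01 _ _|w alpha0 alpha y _ _ _ _]; first by exists w.
exists 0; first by rewrite lexx ler01.
have xE : extrapolate 0 x xprev = x.
  by rewrite /extrapolate addr0 scale1r scale0r subr0.
by rewrite xE.
Qed.

End AlgorithmStep.

Lemma norm_extrapolate_le (x y : H) w r : 0 <= w <= 1 -> `|x| <= r -> `|y| <= r ->
  `|extrapolate w x y| <= 3 * r.
Proof.
move=> /andP[w0 w1] xr yr; rewrite /extrapolate (le_trans (ler_normB _ _)) // !normrZ.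
rewrite !ger0_norm //; last by rewrite addr_ge0.
have := normr_ge0 x; have := normr_ge0 y; move: `|x| `|y| xr yr => a b; nra.
Qed.

Lemma dist_extrapolate_le (x y z : H) w : 0 <= w <= 1 ->
  `|extrapolate w x y - z| <= `|x - z| + `|y - x|.
Proof.
move=> /andP[w0 w1].
have -> : extrapolate w x y - z = (x - z) + w *: (x - y).
  rewrite /extrapolate scalerDl scale1r scalerBr -!addrA; congr (x + _).
  by rewrite addrA addrC.
rewrite (le_trans (ler_normD _ _)) // lerD2l normrZ ger0_norm // distrC.
by rewrite -[leRHS]mul1r ler_wpM2r.
Qed.

End Convergence.

Theorem theorem4p5 (R : realType) (d : nat) (d_ge1 : (1 <= d)%N)
  (B : 'M[R]_d) (B_unit : B \in unitmx) (xi tau gamma : R)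
  (N : 'I_d -> nat) (N_even : forall j, ~~ odd (N j))
  (E := energy B xi tau gamma : hfam R N -> R)
  (E_bounded : has_lbound (range E))
  (rho eta delta : R) (rho_01 : 0 < rho < 1)
  (delta_gt0 : 0 < delta) (delta_le_eta : delta <= eta) (Nmax : nat)
  (Phi : nat -> hfam R N) (w alpha : nat -> R) (kada : nat -> nat)
  (run : apg_run (energyF tau gamma) (energyG B xi) rho eta delta Nmax
           Phi w alpha kada)
  (c : hfam R N) (r : R) (M := closed_ball_ Num.norm c r)
  (sublevel_M : [set phi | E phi <= E (Phi 0%N)] `<=` M)
  (Phi_M : forall k, M (Phi k))
  (abar : \bar R)
  (liminf_alpha : limn_einf (fun k => (alpha k)%:E) = abar)
  (abar_gt0 : (0 < abar)%E) :
  exists Phistar : hfam R N,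
    is_gradient E Phistar 0 /\ Phi @ \oo --> Phistar.
Proof.
have [_ _ _ step] := run.
have Phi_r n : `|Phi n| <= `|c| + r.
  have -> : Phi n = c - (c - Phi n) by rewrite opprB addrC subrK.
  by rewrite (le_trans (ler_normB _ _)) // lerD2l; exact: Phi_M.
set r' := `|c| + r in Phi_r; have r'0 : 0 <= r' by apply: le_trans (Phi_r 0%N).
rewrite -liminf_alpha in abar_gt0; have [a a0 [n0 alpha_ge]] := limn_einf_gt0 abar_gt0.
have [C C0 slope] := @prox_step_slope R d N B xi tau gamma (3 * r') a a0.
have [||l [gl xl]] := @descent_converges _ _ _ E (fun n => Phi (n + n0.+1)%N) r' delta C
  (energy_polyfun N B xi tau gamma) (fun n => Phi_r _) delta_gt0 C0 E_bounded.
- by move=> n; apply: (apg_step_descent (step (n + n0.+1)%N _)); rewrite // addnS.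
- move=> n; set k := (n.+1 + n0.+1)%N.
  have [|w' w01 PhiE] := apg_step_prox (step k _); first by rewrite /k addnS.
  have := slope (extrapolate w' (Phi k) (Phi k.-1)) (alpha k).
  have -> : (n.+2 + n0.+1)%N = k.+1 by [].
  have -> : (n + n0.+1)%N = k.-1 by rewrite /k addSn.
  rewrite -PhiE => sl; apply: le_trans (sl _ _ _) _.
  + exact: alpha_ge (leq_trans (leqnSn n0) (leq_addl _ _)).
  + exact: norm_extrapolate_le.
  + by have := Phi_r k.+1; lra.
  by rewrite ler_wpM2l // dist_extrapolate_le.
by exists l; split=> //; move: xl; rewrite (cvg_shiftn n0.+1).
Qed.
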